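(* If there is a Whitehead group of cardinality $\aleph_1$ which is not a Shelah group, then there is an abelian group which is hereditarily separable but not a Whitehead group.
   Context: An abelian group $G$ is a Whitehead group if $\mathrm{Ext}(G,\mathbb{Z})=0$. A group is separable if every finite rank pure subgroup is a free direct summand; hereditarily separable if every subgroup is separable. A group $G$ is $\aleph_1$-free if every countable subgroup is free. A Shelah group is an abelian group $G$ of cardinality $\aleph_1$ which is $\aleph_1$-free and such that for every countable subgroup $B$ there is a countable subgroup $B'\supseteq B$ such that for every countable subgroup $C$ of $G$ with $C\cap B'=B$, the quotient $C/B$ is free. *)

(* Defs.v *)
From HB Require Import structures.
From mathcomp Require Import all_boot all_order all_algebra.
From mathcomp Require Import boolp classical_sets functions cardinality.

Set Implicit Arguments.
Unset Strict Implicit.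
Unset Printing Implicit Defensive.

Import GRing.Theory.

Local Open Scope classical_set_scope.
Local Open Scope card_scope.
Local Open Scope ring_scope.

(* Abelian groups are [zmodType]s, and subgroups of [G] are terms of type
   [zmodClosed G].  These carry a choice operator and boolean membership, which
   classically is no restriction: by boolp every type is a choiceType and every
   predicate is boolean. *)

Section Subgroups.
Variable G : zmodType.

Record subgrp (S : zmodClosed G) : Type :=
  Subgrp { subgrp_val : G; subgrp_valP : subgrp_val \in S }.

HB.instance Definition _ (S : zmodClosed G) := [isSub of subgrp S for @subgrp_val S].
HB.instance Definition _ (S : zmodClosed G) := [Choice of subgrp S by <:].
HB.instance Definition _ (S : zmodClosed G) :=
  [SubChoice_isSubZmodule of subgrp S by <:].

Definition relative (B C : zmodClosed G) : pred (subgrp C) :=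
  fun x => val x \in B.

Fact relative_zmod_closed (B C : zmodClosed G) : zmod_closed (relative B (C := C)).
Proof.
split=> [|x y xB yB]; rewrite unfold_in /relative.
  by rewrite raddf0 rpred0.
by rewrite raddfB rpredB.
Qed.

HB.instance Definition _ (B C : zmodClosed G) :=
  GRing.isZmodClosed.Build (subgrp C) (@relative B C)
    (relative_zmod_closed B C).

(* C / B, intended for B contained in C. *)
Definition subgrp_quot (C B : zmodClosed G) : zmodType :=
  Quotient.quot (GRing.ZmodClosed.clone (subgrp C) (@relative B C) _).

Definition countable_subgrp (S : zmodClosed G) : Prop :=
  countable [set x : G | x \in S].

End Subgroups.

Section FreeAndSeparable.
Variable G : zmodType.

Definition independent (X : set G) : Prop :=
  forall (s : seq G) (n : G -> int), uniq s -> {in s, forall x, X x} ->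
    \sum_(x <- s) x *~ n x = 0 -> {in s, forall x, n x = 0}.

Definition generates (X : set G) : Prop :=
  forall g : G, exists (s : seq G) (n : G -> int),
    {in s, forall x, X x} /\ g = \sum_(x <- s) x *~ n x.

Definition free_group : Prop :=
  exists X : set G, independent X /\ generates X.

(* The rank is the largest size of an independent set over the integers, so
   torsion elements do not count. *)
Definition finite_rank : Prop :=
  exists r : nat, forall s : seq G,
    uniq s -> independent [set` s] -> (size s <= r)%N.

Definition pure (S : zmodClosed G) : Prop :=
  forall (m : nat) (g : G), g *+ m \in S -> exists2 h, h \in S & g *+ m = h *+ m.

Definition direct_summand (S : zmodClosed G) : Prop :=
  exists T : zmodClosed G,
    (forall x, x \in S -> x \in T -> x = 0) /\
    (forall g, exists x y, [/\ x \in S, y \in T & g = x + y]).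

End FreeAndSeparable.

Definition separable (G : zmodType) : Prop :=
  forall S : zmodClosed G, pure S -> finite_rank (subgrp S) ->
    free_group (subgrp S) /\ direct_summand S.

Definition hereditarily_separable (G : zmodType) : Prop :=
  forall S : zmodClosed G, separable (subgrp S).

Definition aleph1_free (G : zmodType) : Prop :=
  forall S : zmodClosed G, countable_subgrp S -> free_group (subgrp S).

(* aleph_1 is the least uncountable cardinal; every cardinal below that of [T]
   is the cardinal of a subset of [T]. *)
Definition cardinality_aleph1 (T : Type) : Prop :=
  ~ countable [set: T] /\
  forall A : set T, ~ countable A -> A #= [set: T].

Definition shelah_group (G : zmodType) : Prop :=
  [/\ cardinality_aleph1 G,
      aleph1_free G &
      forall B : zmodClosed G, countable_subgrp B ->
        exists B' : zmodClosed G,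
          [/\ countable_subgrp B',
              (forall x, x \in B -> x \in B') &
              forall C : zmodClosed G, countable_subgrp C ->
                (forall x, (x \in C /\ x \in B') <-> x \in B) ->
                free_group (subgrp_quot C B)]].

(* Ext(C, A) as the set of equivalence classes of short exact sequences
   0 -> A -> E -> C -> 0, whose zero for the Baer sum is the class of the
   split sequence. *)
Record extension (C A : zmodType) := Extension {
  ext_mid : zmodType;
  ext_inj : {additive A -> ext_mid};
  ext_proj : {additive ext_mid -> C};
  ext_injective : injective ext_inj;
  ext_surjective : forall c, exists e, ext_proj e = c;
  ext_exact : forall e, ext_proj e = 0 <-> exists a, ext_inj a = e
}.

Definition ext_equiv (C A : zmodType) (E F : extension C A) : Prop :=
  exists f : {additive ext_mid E -> ext_mid F},
    [/\ bijective f,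
        forall a, f (ext_inj E a) = ext_inj F a &
        forall e, ext_proj F (f e) = ext_proj E e].

Section SplitExtension.
Variables C A : zmodType.

Definition split_inj (a : A) : A * C := (a, 0).

Fact split_inj_zmod_morphism : zmod_morphism split_inj.
Proof. by move=> a b; rewrite /split_inj -[in LHS](subrr 0). Qed.

HB.instance Definition _ :=
  GRing.isZmodMorphism.Build A (A * C)%type split_inj split_inj_zmod_morphism.

Definition split_proj : {additive (A * C)%type -> C} := snd.

Fact split_injective : injective split_inj.
Proof. by move=> a b []. Qed.

Fact split_surjective (c : C) : exists e, split_proj e = c.
Proof. by exists (0, c). Qed.

Fact split_exact (e : A * C) : split_proj e = 0 <-> exists a, split_inj a = e.
Proof.
by split=> [|[a <-]//]; case: e => a c /= ->; exists a.
Qed.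

Definition split_extension : extension C A :=
  Extension split_injective split_surjective split_exact.

End SplitExtension.

Definition Ext (C A : zmodType) : Type :=
  {X : extension C A -> Prop | exists E, X = ext_equiv E}.

Definition Ext_zero (C A : zmodType) : Ext C A :=
  exist _ (ext_equiv (split_extension C A)) (ex_intro _ _ erefl).

Definition whitehead (G : zmodType) : Prop :=
  forall x : Ext G int, x = Ext_zero G int.

(* Main.v *)
(* Let G be a Whitehead group that is not a Shelah group.  Failure of the Shelah
   property yields a countable pure subgroup B and uncountably many finite tuples
   t whose pure closures are non-free over B and independent modulo B.  As G is
   Whitehead, every prescribed system of homomorphisms from these closures modulo
   B to Q / Z lifts to a homomorphism psi : G -> Q, and psi(B) lies in Z.  Whether
   psi restricted to B extends to the closure of t is an F_sigma property of a
   real coding the divisibility relations of t over B, because t is finite; and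
   it can be made true or false for each t independently.  So the codes a_i form
   an uncountable Q-set.

   Let H be generated by elements x_s (s a finite 0-1 sequence), y_i and
   (y_i + x_(a_i|n)) / p_n, with distinct primes p_n.  If H were Whitehead, some
   psi would satisfy psi(y_i) + psi(x_(a_i|n)) = a_i(n) mod p_n for all i and n;
   then psi(y_i) determines a_i, which is impossible for uncountably many i.  On
   the other hand, to build functionals on a subgroup of H one has to solve
   congruences v_i + u_(a_i|n) = 0 mod p_n in which v_i does not depend on n:
   this is a uniformization problem for colours constant along each branch, which
   a Q-set can solve. *)

Require Import Defs.
From HB Require Import structures.
From mathcomp Require Import all_boot all_order all_algebra.
From mathcomp Require Import boolp classical_sets functions cardinality.
From mathcomp.multinomials Require Import freeg.
From mathcomp Require Import zify ring lra.

Set Implicit Arguments.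
Unset Strict Implicit.
Unset Printing Implicit Defensive.

Import GRing.Theory Num.Theory Order.TTheory.

Local Open Scope classical_set_scope.
Local Open Scope ring_scope.
Local Open Scope quotient_scope.

(** * Homomorphisms to Q modulo a subgroup *)

Section ZSub.
Variable G : zmodType.

(** Since Ext(G, Q) = 0, a group G is Whitehead exactly when every homomorphism G -> Q / Z lifts to
    Q. The passage from Whitehead to lifting serves twice: it provides psi on G, and it is refuted
    for H.

    The primes p_n are distinct so that a single change of v_i can meet the congruences at finitely
    many nodes. It therefore suffices to guess the colour of i from initial segments of a_i in such
    a way that the guess is right from some node on: a changed guess is recomputed to fit the nodes
    already passed, and later nodes are fitted to the guess. Such guessing is possible because there
    are only countably many colours and each of them marks an F_sigma set of branches.

    A functional has to be integral at infinitely many primes. The finitely many primes dividing a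
    modulus M are handled by extending a homomorphism from a subgroup, the other p_n by the tree. *)

Definition zsub (E : G -> Prop) : Prop :=
  E 0 /\ forall x y, E x -> E y -> E (x - y).

Variable E : G -> Prop.
Hypothesis zE : zsub E.

Lemma zsub0 : E 0. Proof. by case: zE. Qed.

Lemma zsubB x y : E x -> E y -> E (x - y). Proof. by case: zE => _; apply. Qed.

Lemma zsubN x : E x -> E (- x).
Proof. by move=> Ex; rewrite -sub0r; apply: zsubB => //; exact: zsub0. Qed.

Lemma zsubD x y : E x -> E y -> E (x + y).
Proof. by move=> Ex Ey; rewrite -[y]opprK; apply: zsubB => //; exact: zsubN. Qed.

Lemma zsubMn x n : E x -> E (x *+ n).
Proof.
move=> Ex; elim: n => [|n IH]; first by rewrite mulr0n; exact: zsub0.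
by rewrite mulrS; exact: zsubD.
Qed.

Lemma zsubMz x m : E x -> E (x *~ m).
Proof.
case: m => n Ex; first by rewrite -pmulrn; exact: zsubMn.
by rewrite NegzE -nmulrn; apply: zsubN; exact: zsubMn.
Qed.

Lemma zsub_sum (T : eqType) (s : seq T) (F : T -> G) :
  {in s, forall i, E (F i)} -> E (\sum_(i <- s) F i).
Proof.
move=> sE; rewrite big_seq; apply: (big_ind E); [exact: zsub0|exact: zsubD|exact: sE].
Qed.

Definition zsub_pred of zsub E : pred G := fun x => `[< E x >].

Fact zsub_pred_closed : zmod_closed (zsub_pred zE).
Proof.
split=> [|x y /asboolP Ex /asboolP Ey]; apply/asboolP; first exact: zsub0.
exact: zsubB.
Qed.

HB.instance Definition _ :=
  GRing.isZmodClosed.Build G (zsub_pred zE) zsub_pred_closed.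

Definition zsub_closed : zmodClosed G :=
  GRing.ZmodClosed.clone G (zsub_pred zE) _.

Lemma zsub_closedP x : reflect (E x) (x \in zsub_closed).
Proof. exact: asboolP. Qed.

End ZSub.

Lemma zsub_int_principal (P : int -> Prop) : zsub P ->
  (exists2 m : nat, (0 < m)%N & P m) ->
  exists d : nat, [/\ (0 < d)%N, P d & forall j, P j -> exists i, j = i * d%:Z].
Proof.
move=> zP [m m0 Pm].
have ex : exists m, (0 < m)%N && `[< P m%:Z >].
  by exists m; rewrite m0; apply/asboolP.
case: (ex_minnP ex) => d /andP[d0 /asboolP Pd] dmin.
exists d; split=> // j Pj; exists (j %/ d)%Z.
rewrite {1}(divz_eq j d); suff -> : (j %% d)%Z = 0 by rewrite addr0.
have Pr : P (j %% d)%Z.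
  have -> : (j %% d)%Z = j - d%:Z *~ (j %/ d)%Z.
    by rewrite {2}(divz_eq j d) mulrzz (mulrC d%:Z) [_ + (j %% d)%Z]addrC addrK.
  by apply: zsubB => //; exact: zsubMz.
have dz : d%:Z != 0 by rewrite eqz_nat -lt0n.
have := ltz_pmod j (_ : 0 < d%:Z); rewrite ltz_nat => /(_ d0).
have := modz_ge0 j dz; case: (j %% d)%Z Pr => // -[//|r] Pr _.
rewrite ltz_nat => rd; have := dmin r.+1; rewrite (asboolT Pr) => /(_ isT).
by rewrite leqNgt rd.
Qed.

Section Extend.
Variables (G : zmodType) (I : rat -> Prop).
Hypothesis zI : zsub I.

(* A subgroup of G x Q meeting 0 x Q inside I is a partial homomorphism from G
   to Q / I. *)
Definition partial_hom (E : G * rat -> Prop) : Prop :=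
  zsub E /\ forall q, E (0, q) -> I q.

Definition adjoin (E : G * rat -> Prop) (u : G * rat) : G * rat -> Prop :=
  fun v => exists2 w, E w & exists j : int, v = w + u *~ j.

Lemma pair_mulrz (u : G * rat) (j : int) : u *~ j = (u.1 *~ j, u.2 *~ j).
Proof.
case: u => a b; have H n : (a, b) *+ n = (a *+ n, b *+ n).
  by elim: n => [|n IH]; rewrite ?mulr0n // !mulrS IH.
by case: j => n; rewrite ?NegzE -?pmulrn -?nmulrn H.
Qed.

Lemma zsub_adjoin E u : zsub E -> zsub (adjoin E u).
Proof.
move=> zE; split=> [|_ _ [w Ew [j ->]] [w' Ew' [j' ->]]].
  by exists 0; [exact: zsub0|exists 0; rewrite mulr0z addr0].
exists (w - w'); first exact: zsubB.
by exists (j - j'); rewrite mulrzBr opprD addrACA.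
Qed.

Lemma adjoin_sub E u : E `<=` adjoin E u.
Proof. by move=> w Ew; exists w => //; exists 0; rewrite mulr0z addr0. Qed.

Lemma adjoin_mem E u : zsub E -> adjoin E u u.
Proof.
by move=> zE; exists 0; [exact: zsub0|exists 1; rewrite mulr1z add0r].
Qed.

Lemma partial_hom_adjoin E g q : partial_hom E ->
  (forall (j : int) e, E (g *~ j, e) -> I (e - q *~ j)) ->
  partial_hom (adjoin E (g, q)).
Proof.
move=> [zE vE] H; split; first exact: zsub_adjoin.
move=> r [[w1 w2] Ew [j]]; rewrite pair_mulrz /= => -[w1E ->].
have -> : w2 + q *~ j = - (- w2 - q *~ j) by rewrite opprB opprK addrC.
apply: zsubN => //; apply: H; have -> : g *~ j = - w1.
  by apply/eqP; rewrite -addr_eq0 addrC -w1E.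
exact: zsubN zE _ Ew.
Qed.

(* The freedom in the choice of the value q / m of the new element is what lets
   one diagonalise later. *)
Lemma partial_hom_adjoin_root E g : partial_hom E ->
  (exists2 m : nat, (0 < m)%N & exists q, E (g *+ m, q)) ->
  exists m : nat, [/\ (0 < m)%N, exists q, E (g *+ m, q) &
    forall q, E (g *+ m, q) -> partial_hom (adjoin E (g, q / m%:R))].
Proof.
move=> pE [m m0 [q Eq]]; have [zE vE] := pE.
pose P (j : int) := exists q, E (g *~ j, q).
have zP : zsub P.
  split; first by exists 0; rewrite mulr0z; exact: zsub0 zE.
  move=> i j [a Ea] [b Eb]; exists (a - b); rewrite mulrzBr.
  exact: zsubB zE _ _ Ea Eb.
have [|d [d0 Pd dP]] := zsub_int_principal zP.
  by exists m => //; exists q.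
exists d; split=> // r Er; apply: partial_hom_adjoin => // j e Ee.
have [i ji] := dP j (ex_intro _ e Ee).
have -> : (r / d%:R) *~ j = r *~ i.
  have d0' : d%:R != 0 :> rat by rewrite pnatr_eq0 -lt0n.
  rewrite ji -(mulrzr (r / _)) -(mulrzr r) intrM -[d%:~R]/(d%:R : rat).
  by field.
apply: vE; have -> : (0 : G, e - r *~ i) = (g *~ j, e) - (g *+ d, r) *~ i.
  rewrite pair_mulrz /=; congr (_, _).
  by rewrite /= ji mulrC mulrzA -pmulrn subrr.
by apply: zsubB => //; exact: zsubMz.
Qed.

(* Q / I is divisible, so partial homomorphisms extend. *)
Lemma partial_hom_extend E0 : partial_hom E0 ->
  exists Phi : G -> rat, (forall g h, I (Phi (g - h) - (Phi g - Phi h))) /\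
    forall g q, E0 (g, q) -> I (q - Phi g).
Proof.
move=> pE0.
pose P (A : set (G * rat)) := partial_hom (A `|` E0).
have Pchain (F : set (set (G * rat))) : F `<=` P -> total_on F subset ->
    P (\bigcup_(X in F) X).
  move=> FP Ftot; split; first split.
  - by right; exact: zsub0 pE0.1.
  - move=> x y; wlog: / exists2 X, F X & (X `|` E0) x /\ (X `|` E0) y.
      move=> W [[X FX Xx]|E0x] [[Y FY Yy]|E0y].
      + have [XY|YX] := Ftot _ _ FX FY.
          by apply: W; [exists Y => //; split; left => //; exact: XY|left; exists X|left; exists Y].
        by apply: W; [exists X => //; split; left => //; exact: YX|left; exists X|left; exists Y].
      + by apply: W; [exists X => //; split; [left|right]|left; exists X|right].
      + by apply: W; [exists Y => //; split; [right|left]|right|left; exists Y].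
      + by right; exact: zsubB pE0.1 _ _ E0x E0y.
    move=> [X FX [Xx Xy]] _ _.
    have [Z|Z] := zsubB (FP _ FX).1 Xx Xy; last by right.
    by left; exists X.
  - move=> q [[X FX X0]|]; last exact: pE0.2.
    by apply: (FP _ FX).2; left.
have [A [PA Amax]] := Zorn_bigcup Pchain.
have [zE vE] := PA; set E := A `|` E0 in zE vE.
have full g : exists q, E (g, q).
  have [q pq] : exists q, partial_hom (adjoin E (g, q)).
    have [ex|nex] := pselect (exists2 m : nat, (0 < m)%N & exists q, E (g *+ m, q)).
      have [m [m0 [q Eq] H]] := partial_hom_adjoin_root PA ex.
      by exists (q / m%:R); exact: H.
    exists 0; apply: partial_hom_adjoin => // -[[|n]|n] e Ee.
    - by rewrite mulr0z subr0; apply: vE; rewrite -[X in (X, _)](mulr0z g).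
    - by case: nex; exists n.+1 => //; exists e.
    - case: nex; exists n.+1 => //; exists (- e).
      have := zsubN zE Ee; rewrite NegzE -nmulrn.
      by rewrite -[- (- _, _)]/(- - _, _) opprK.
  apply: contrapT => nq; apply: (Amax (adjoin E (g, q))).
    split; first by move=> w Aw; apply: adjoin_sub; left.
    move=> /(_ _ (adjoin_mem (g, q) zE)) Agq; apply: nq; exists q; by left.
  rewrite /P; have -> // : adjoin E (g, q) `|` E0 = adjoin E (g, q).
  by apply/setUidl => w E0w; apply: adjoin_sub; right.
have [Phi PhiE] := choice full; exists Phi; split.
  move=> g h; apply: vE.
  have -> : (0, Phi (g - h) - (Phi g - Phi h)) =
      (g - h, Phi (g - h)) - ((g, Phi g) - (h, Phi h)).
    by congr (_, _); rewrite /= subrr.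
  by apply: zsubB => //; exact: zsubB.
move=> g q E0gq; apply: vE.
have -> : (0, q - Phi g) = (g, q) - (g, Phi g) by congr (_, _); rewrite /= subrr.
by apply: zsubB => //; right.
Qed.

End Extend.

(** * The Whitehead property as lifting from Q / Z to Q *)

Definition is_int (q : rat) : Prop := q \is a Num.int.

Lemma is_int0 : is_int 0. Proof. exact: rpred0. Qed.

Lemma zsub_int : zsub is_int.
Proof. by split=> [|x y xi yi]; rewrite /is_int ?rpred0 ?rpredB. Qed.

Section WhiteheadLift.
Variables (G : zmodType) (Phi : G -> rat).
Hypothesis PhiB : forall g h, is_int (Phi (g - h) - (Phi g - Phi h)).

Fact Phi0 : is_int (Phi 0).
Proof. by have := PhiB 0 0; rewrite /is_int !subrr subr0. Qed.

Fact zsub_lift : zsub (fun u : G * rat => is_int (u.2 - Phi u.1)).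
Proof.
split=> [|[x a] [y b] /= ha hb].
  by change (is_int (0 - Phi 0)); rewrite /is_int sub0r rpredN; exact: Phi0.
have -> : a - b - Phi (x - y) =
   (a - Phi x) - (b - Phi y) - (Phi (x - y) - (Phi x - Phi y)) by ring.
by apply: rpredB; [exact: rpredB|exact: PhiB].
Qed.

Definition lift_group : zmodType := subgrp (zsub_closed zsub_lift).

Fact lift_inj_subproof (a : int) :
  (0 : G, a%:~R : rat) \in zsub_closed zsub_lift.
Proof. by apply/zsub_closedP/rpredB; [exact: intr_int|exact: Phi0]. Qed.

Definition lift_inj (a : int) : lift_group := Subgrp (lift_inj_subproof a).
Definition lift_proj (u : lift_group) : G := (val u).1.

Fact lift_inj_morph : zmod_morphism lift_inj.
Proof.
by move=> a b; apply: val_inj; rewrite [RHS]raddfB /= intrB; congr (_, _); rewrite /= subrr.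
Qed.

Fact lift_proj_morph : zmod_morphism lift_proj.
Proof. by move=> a b; rewrite /lift_proj raddfB. Qed.

HB.instance Definition _ :=
  GRing.isZmodMorphism.Build int lift_group lift_inj lift_inj_morph.
HB.instance Definition _ :=
  GRing.isZmodMorphism.Build lift_group G lift_proj lift_proj_morph.

Fact lift_inj_injective : injective lift_inj.
Proof. by move=> a b /(congr1 val) [] /intr_inj. Qed.

Fact lift_point_subproof g : (g, Phi g) \in zsub_closed zsub_lift.
Proof. by apply/zsub_closedP; rewrite /is_int /= subrr rpred0. Qed.

Fact lift_proj_surjective g : exists e, lift_proj e = g.
Proof. by exists (Subgrp (lift_point_subproof g)). Qed.

Fact lift_exact e : lift_proj e = 0 <-> exists a, lift_inj a = e.
Proof.
split=> [|[a <-//]]; case: e => -[g q] gq; rewrite /lift_proj /= => g0.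
move/zsub_closedP: (gq); rewrite /is_int /= [in Phi g]g0 => qi.
have /intrP[a qa] : q \is a Num.int by rewrite -(subrK (Phi 0) q) rpredD //; exact: Phi0.
by exists a; apply: val_inj; rewrite /= g0 qa.
Qed.

Definition lift_extension : extension G int :=
  @Extension G int lift_group lift_inj lift_proj
    lift_inj_injective lift_proj_surjective lift_exact.

(** An equivalence with the split extension gives a retraction [r] of [lift_group] onto Z. Then (g,
    q) -> q - r (g, q) kills Z, hence factors through G, and is the lift. *)
Lemma whitehead_lift : whitehead G ->
  exists psi : G -> rat, (forall g h, psi (g - h) = psi g - psi h) /\
    forall g, is_int (psi g - Phi g).
Proof.
move=> /(_ (exist _ (ext_equiv lift_extension) (ex_intro _ _ erefl))) /(congr1 sval) /= eqE.
have : ext_equiv lift_extension (split_extension G int).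
  rewrite eqE; exists idfun; split=> //; exact: (Bijective (g := id)).
move=> [f [_ fi _]].
pose r (u : lift_group) : int := (f u).1.
have rB u v : r (u - v) = r u - r v by rewrite /r raddfB.
have ri a : r (lift_inj a) = a by rewrite /r fi.
pose pt g : lift_group := Subgrp (lift_point_subproof g).
exists (fun g => Phi g - (r (pt g))%:~R); split; last first.
  by move=> g; rewrite /is_int addrC addKr rpredN intr_int.
move=> g h; have /intrP[a aE] := PhiB g h.
have : pt (g - h) = pt g - pt h + lift_inj a.
  apply: val_inj; rewrite raddfD raddfB /=; congr (_, _); rewrite /= ?addr0 //.
  by rewrite -aE; ring.
have rD u v : r (u + v) = r u + r v by rewrite /r raddfD.
move=> /(congr1 r); rewrite rD rB ri => ->.
rewrite !rmorphD rmorphN /= -aE; ring.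
Qed.

End WhiteheadLift.

Lemma additive_of (U V : zmodType) (f : U -> V) :
  (forall x y, f (x - y) = f x - f y) -> exists g : {additive U -> V}, g =1 f.
Proof.
by move=> fB; exists (HB.pack_for {additive U -> V} f (GRing.isZmodMorphism.Build U V f fB)).
Qed.

(** Q / Z is injective, so a homomorphism to it may be prescribed on a subgroup only. The Whitehead
    property is used below in this form alone. *)
Lemma whitehead_extend (G : zmodType) (E0 : G * rat -> Prop) :
  whitehead G -> partial_hom is_int E0 ->
  exists psi : {additive G -> rat}, forall g q, E0 (g, q) -> is_int (psi g - q).
Proof.
move=> wG pE; have [Phi [PhiB PhiE]] := partial_hom_extend zsub_int pE.
have [f [/additive_of[psi psif] psiE]] := whitehead_lift PhiB wG.
exists psi => g q /PhiE qP; rewrite psif /is_int.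
have -> : f g - q = (f g - Phi g) - (q - Phi g) by ring.
by rewrite rpredB //; exact: psiE.
Qed.

(** * Pontryagin's criterion *)

Definition torsion_free (G : zmodType) : Prop :=
  forall (g : G) (m : nat), (0 < m)%N -> g *+ m = 0 -> g = 0.

Lemma torsion_free_inj (G : zmodType) (g h : G) m : torsion_free G ->
  (0 < m)%N -> g *+ m = h *+ m -> g = h.
Proof.
move=> tf m0 gh; apply/eqP; rewrite -subr_eq0; apply/eqP/(tf _ m) => //.
by rewrite mulrnBl gh subrr.
Qed.

Section Span.
Variable G : zmodType.

Definition lincomb (c : nat -> G) r (f : nat -> int) : G :=
  \sum_(i < r) c i *~ f i.

Lemma lincombB c r f f' :
  lincomb c r f - lincomb c r f' = lincomb c r (fun i => f i - f' i).
Proof. by rewrite -sumrB; apply: eq_bigr => i _; rewrite mulrzBr. Qed.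

Lemma lincomb0 c r : lincomb c r (fun=> 0) = 0.
Proof. by rewrite /lincomb big1 // => i _; rewrite mulr0z. Qed.

Lemma lincomb_proj c r i : (i < r)%N ->
  lincomb c r (fun k => (k == i)%:R) = c i.
Proof.
move=> ir; rewrite /lincomb (bigD1 (Ordinal ir)) //= eqxx mulr1z big1 ?addr0 //.
by move=> k; rewrite -val_eqE /= => /negbTE ->; rewrite mulr0z.
Qed.

Lemma eq_lincomb c r f f' : {in gtn r, f =1 f'} ->
  lincomb c r f = lincomb c r f'.
Proof. by move=> ff'; apply: eq_bigr => i _; rewrite ff' // inE. Qed.

Variable B : G -> Prop.
Hypothesis zB : zsub B.

Definition span_mod (c : nat -> G) r (g : G) : Prop :=
  exists b f, B b /\ g = b + lincomb c r f.

Definition pure_span (c : nat -> G) r (g : G) : Prop :=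
  exists2 m, (0 < m)%N & span_mod c r (g *+ m).

Lemma zsub_span c r : zsub (span_mod c r).
Proof.
split; first by exists 0, (fun=> 0); rewrite lincomb0 addr0; split=> //; exact: zsub0.
move=> _ _ [b [f [Bb ->]]] [b' [f' [Bb' ->]]].
exists (b - b'), (fun i => f i - f' i); split; first exact: zsubB.
by rewrite opprD addrACA lincombB.
Qed.

Lemma span_pure c r g : span_mod c r g -> pure_span c r g.
Proof. by exists 1%N. Qed.

Lemma base_span c r b : B b -> span_mod c r b.
Proof. by move=> Bb; exists b, (fun=> 0); rewrite lincomb0 addr0. Qed.

Lemma mem_span c r i : (i < r)%N -> span_mod c r (c i).
Proof.
move=> ir; exists 0, (fun k => (k == i)%:R).
by rewrite add0r lincomb_proj //; split=> //; exact: zsub0.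
Qed.

Lemma zsub_pure_span c r : zsub (pure_span c r).
Proof.
have zS := zsub_span c r.
split=> [|x y [m m0 xm] [n n0 yn]]; first by exists 1%N => //; exact: zsub0 zS.
exists (m * n)%N; first by rewrite muln_gt0 m0.
rewrite mulrnBl; apply: (zsubB zS); first by rewrite mulrnA; exact: zsubMn.
by rewrite mulnC mulrnA; exact: zsubMn.
Qed.

Lemma pure_span_root c r g m : (0 < m)%N ->
  pure_span c r (g *+ m) -> pure_span c r g.
Proof.
move=> m0 [n n0]; rewrite -mulrnA => H.
by exists (m * n)%N => //; rewrite muln_gt0 m0.
Qed.

(** The pure closure has unbounded exponent modulo the span. For pure [B] this means that it is not
    finitely generated over [B]; the [c i] need not be independent. *)
Definition unbounded_span (c : nat -> G) r : Prop :=
  forall M, (0 < M)%N -> exists2 g, pure_span c r g & ~ span_mod c r (g *+ M).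

End Span.

Section Pontryagin.
Variable A : zmodType.
Hypothesis tf : torsion_free A.

Let triv (x : A) : Prop := x = 0.

Let ztriv : zsub triv.
Proof. by split=> // x y -> ->; rewrite /triv subrr. Qed.

(** Boundedness makes the quotients of consecutive pure closures of initial segments of [c] cyclic,
    and they are torsion-free. Generators of the nonzero ones form a basis; [e n = 0] records a zero
    quotient. *)
Lemma pontryagin (c : nat -> A) : (forall g, exists n, c n = g) ->
  (forall n, ~ unbounded_span triv c n) -> free_group A.
Proof.
move=> csurj bdd; pose PC n := pure_span triv c n; pose SC n := span_mod triv c n.
have zPC n : zsub (PC n) by exact: zsub_pure_span.
have SCP n g : SC n g <-> exists f, g = lincomb c n f.
  split=> [[b [f [-> ->]]]|[f ->]]; first by exists f; rewrite add0r.
  by exists 0, f; rewrite add0r.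
have SCw n g : SC n g -> SC n.+1 g.
  move/SCP=> [f ->]; apply/SCP.
  exists (fun i => if (i == n)%N then 0 else f i).
  rewrite /lincomb big_ord_recr /= eqxx mulr0z addr0.
  by apply: eq_bigr => i _; rewrite ltn_eqF.
have PCw n g : PC n g -> PC n.+1 g by move=> [m m0 H]; exists m => //; exact: SCw.
have PCle n k g : (n <= k)%N -> PC n g -> PC k g.
  by move=> /subnK <-; elim: (k - n)%N => // j IH /IH /PCw.
have step n : exists e, [/\ PC n.+1 e,
    forall g, PC n.+1 g -> exists i : int, PC n (g - e *~ i) & PC n e -> e = 0].
  have [M M0 MP] : exists2 M, (0 < M)%N & forall g, PC n.+1 g -> SC n.+1 (g *+ M).
    apply: contrapT => H; apply: (bdd n.+1) => M M0.
    apply: contrapT => H'; apply: H; exists M => // g Pg.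
    by apply: contrapT => H''; apply: H'; exists g.
  (* Modulo [PC n], multiples by [M] of elements of [PC n.+1] are multiples of [c n]. The
     coefficients form an ideal, and an element realizing its generator generates [PC n.+1] over
     [PC n]. *)
  pose P (j : int) := exists g, PC n (g *+ M - c n *~ j).
  have zP : zsub P.
    split; first by exists 0; rewrite mul0rn mulr0z subr0; exact: zsub0.
    move=> i j [g Pg] [h Ph]; exists (g - h).
    rewrite [X in PC n X](_ : _ = (g *+ M - c n *~ i) - (h *+ M - c n *~ j)).
      exact: zsubB.
    by rewrite mulrnBl mulrzBr !opprD addrACA.
  have [|d [d0 [e0 Pe] dP]] := zsub_int_principal zP.
    by exists M => //; exists (c n); rewrite -pmulrn subrr; exact: zsub0.
  have e0P : PC n.+1 e0.
    apply: (pure_span_root M0); rewrite -[e0 *+ M](subrK (c n *~ d)).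
    apply: (zsubD (zPC _)); first exact: PCw.
    apply: (zsubMz (zPC _)); apply: span_pure; exact: mem_span.
  have e0S g : PC n.+1 g -> exists i : int, PC n (g - e0 *~ i).
    move=> /MP /SCP[f gE].
    have Pj : PC n (g *+ M - c n *~ f n).
      apply/span_pure/SCP; exists f.
      by rewrite gE /lincomb big_ord_recr /= addrK.
    have [i fE] := dP _ (ex_intro _ g Pj); exists i.
    apply: (pure_span_root M0).
    rewrite [X in pure_span _ _ _ X](_ : _ = (g *+ M - c n *~ f n) - (e0 *+ M - c n *~ d) *~ i).
      by apply: (zsubB (zPC n)) => //; exact: zsubMz.
    have cE : c n *~ d *~ i = c n *~ f n by rewrite fE mulrC mulrzA.
    rewrite mulrnBl mulrzBl cE opprB addrA subrK; congr (_ - _).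
    by rewrite [LHS]pmulrn [e0 *+ M]pmulrn -!mulrzA mulrC.
  have [Pe0|nPe0] := pselect (PC n e0); last by exists e0; split.
  exists 0; split=> //; first exact: zsub0.
  move=> g /e0S[i Hi]; exists 0; rewrite mulr0z subr0 -(subrK (e0 *~ i) g).
  by apply: (zsubD (zPC n)) => //; exact: zsubMz.
have {step} [e eP] := choice step.
have PCe i k : (i < k)%N -> PC k (e i) by move=> ik; apply: PCle ik _; case: (eP i).
have einj i j : e i != 0 -> e i = e j -> i = j.
  move=> + eij; have /orP[] := leq_total i j; rewrite leq_eqVlt => /orP[/eqP//|lt].
    move=> /eqP; case; rewrite eij; have [_ _] := eP j; apply.
    by rewrite -eij; exact: PCe.
  move=> /eqP; case; have [_ _] := eP i; apply.
  by rewrite eij; exact: PCe.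
pose X : set A := fun x => exists2 i, x = e i & x != 0.
exists X; split.
(* The largest index decides: a relation puts a multiple of [e k] into [PC k], hence by purity [e k]
   itself unless its coefficient is 0. *)
- suff H k : forall (s : seq A) (n : A -> int), uniq s ->
      {in s, forall x, exists i, [/\ (i < k)%N, x = e i & x != 0]} ->
      \sum_(x <- s) x *~ n x = 0 -> {in s, forall x, n x = 0}.
    move=> s n us sX; apply: (H (\max_(x <- s) (xget 0%N [set i | x = e i])).+1) => //.
    move=> x xs; have [i xE x0] := sX x xs; exists (xget 0%N [set i | x = e i]).
    split=> //; last by have := xgetPex 0%N (ex_intro (fun i => x = e i) i xE).
    by rewrite ltnS; apply: (@leq_bigmax_seq _ s xpredT (fun x => xget 0%N [set i | x = e i])).
  elim: k => [s n _ sX _ x /sX[i []]//|k IH s n us sX s0].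
  have [eks|eks] := boolP (e k \in s); last first.
    apply: IH => // x xs; have [i [ik xE x0]] := sX x xs; exists i; split=> //.
    move: ik; rewrite ltnS leq_eqVlt => /orP[/eqP ik|//].
    by rewrite -ik -xE xs in eks.
  have [_ [_ _ ek0]] := sX _ eks.
  have remX : {in rem (e k) s, forall x, exists i, [/\ (i < k)%N, x = e i & x != 0]}.
    move=> x; rewrite mem_rem_uniq // !inE => /andP[/eqP xk xs].
    have [i [ik xE x0]] := sX x xs; exists i; split=> //.
    by move: ik; rewrite ltnS leq_eqVlt => /orP[/eqP ik|//]; rewrite ik in xE.
  have sE : e k *~ n (e k) + \sum_(x <- rem (e k) s) x *~ n x = 0.
    by rewrite -[RHS]s0 [RHS](perm_big _ (perm_to_rem eks)) /= big_cons.
  have nk : n (e k) = 0.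
    apply: contrapT => nk0; case: (eP k) => _ _ Pk.
    move: ek0; rewrite Pk ?eqxx //.
    have : PC k (e k *~ n (e k)).
      have /eqP := sE; rewrite addr_eq0 => /eqP ->; apply: zsubN => //.
      apply: zsub_sum => // x xs; apply: zsubMz => //.
      by have [i [ik -> _]] := remX x xs; exact: PCe.
    move: nk0; case: (n (e k)) => [[|m]|m] // _; first by move/pure_span_root; apply.
    by rewrite NegzE -nmulrn => /(zsubN (zPC k)); rewrite opprK => /pure_span_root; apply.
  move: sE; rewrite nk mulr0z add0r => s'0 x xs.
  have [->//|xk] := eqVneq x (e k).
  apply: (IH (rem (e k) s)) => //; first exact: rem_uniq.
  by rewrite mem_rem_uniq // !inE xk.
- move=> g; have [n0 cg] := csurj g.
  have gP : PC n0.+1 g by rewrite -cg; apply/span_pure/mem_span.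
  have {gP}[f gE] : exists f : nat -> int, g = lincomb e n0.+1 f.
    elim: n0.+1 g gP {cg} => [g [m m0 /SCP[f]]|n IH g].
      rewrite /lincomb big_ord0 => /tf -> //; exists (fun=> 0).
      by rewrite /lincomb big_ord0.
    move=> Pg; have [_ /(_ _ Pg)[i /IH[f gE]] _] := eP n.
    exists (fun k => if (k == n)%N then i else f k).
    rewrite -(subrK (e n *~ i) g) gE /lincomb big_ord_recr /= eqxx; congr (_ + _).
    by apply: eq_bigr => j _; rewrite ltn_eqF.
  pose N := n0.+1; pose l := [seq i <- iota 0 N | e i != 0].
  exists [seq e i | i <- l], (fun x => f (index x (mkseq e N))); split.
    by move=> _ /mapP[i + ->]; rewrite mem_filter => /andP[ei _]; exists i.
  rewrite big_map big_filter big_mkcond /= gE /lincomb -(big_mkord predT (fun i => e i *~ f i)).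
  rewrite /index_iota subn0 !big_seq; apply: eq_bigr => i; rewrite mem_iota /= add0n => iN.
  case: ifPn => [ei|]; last by rewrite negbK => /eqP ->; rewrite mul0rz.
  congr (_ *~ f _); have xin : e i \in mkseq e N by apply/mapP; exists i; rewrite ?mem_iota.
  apply: (einj _ _ ei); have := nth_index 0 xin; rewrite nth_mkseq //.
  by rewrite -[X in (_ < X)%N](size_mkseq e) index_mem.
Qed.

End Pontryagin.

(** * Diagonalisation *)

Lemma int_invn (m : nat) : (0 < m)%N -> is_int m%:R^-1 -> m = 1%N.
Proof.
move=> m0 /intrP[z zE]; have mn0 : m%:R != 0 :> rat by rewrite pnatr_eq0 -lt0n.
have : (z * m%:Z)%:~R = 1%:~R :> rat by rewrite intrM -zE mulVf.
move/intr_inj => zm; have [z0|z1] : (z <= 0) \/ (1 <= z) by lia.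
  by nia.
by nia.
Qed.

Section Diagonal.
Variables (G : zmodType) (B : G -> Prop) (c : nat -> G) (r : nat).
Hypothesis zB : zsub B.

Let span := span_mod B c r.
Let PC := pure_span B c r.

(** A homomorphism to Q that vanishes on [B] and maps [c i] to [w i] would be determined on the pure
    closure; here it disagrees with [E] modulo Z at some point. *)
Definition avoids (E : G * rat -> Prop) (w : nat -> int) : Prop :=
  exists g q m b f, [/\ E (g, q), (0 < m)%N, B b, g *+ m = b + lincomb c r f &
    ~ is_int ((lincomb w r f)%:~R / m%:R - q)].

(** The exponent bound leaves room: no such stage exhausts an unbounded pure closure. *)
Let bounded_hom (E : G * rat -> Prop) : Prop :=
  [/\ partial_hom is_int E, forall u, E u -> PC u.1,
      forall u, span u.1 -> is_int u.2 -> E u &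
      exists2 M, (0 < M)%N & forall u, E u -> span (u.1 *+ M)].

Hypothesis ubd : unbounded_span B c r.

(** Unboundedness supplies [g] outside the domain, with a multiple [g *+ m], m > 1, inside it. As q
    and q + 1 are both values there, q / m and (q + 1) / m are both admissible at [g]; they differ
    by 1 / m, so at most one agrees with [w] modulo Z. *)
Fact avoid_step E w : bounded_hom E ->
  exists E', [/\ bounded_hom E', E `<=` E' & avoids E' w].
Proof.
move=> [pE EPC Espan [M M0 EM]].
have zS : zsub span by exact: zsub_span.
have zP : zsub PC by exact: zsub_pure_span.
have [g Pg nMg] := ubd M0.
have [k k0 [b [f [Bb gk]]]] := Pg.
have [|m [m0 [q Eq] mP]] := @partial_hom_adjoin_root _ _ zsub_int E g pE.
  by exists k => //; exists 0; apply: Espan; [exists b, f|exact: rpred0].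
have m1 : (1 < m)%N.
  rewrite ltn_neqAle m0 andbT; apply/eqP => m1.
  by move: Eq => /EM /=; rewrite -m1 mulr1n => /nMg.
have Eq1 : E (g *+ m, q + 1).
  have -> : (g *+ m, q + 1) = (g *+ m, q) + (0, 1) by congr (_, _); rewrite /= addr0.
  apply: (zsubD pE.1) => //; apply: Espan; first exact: zsub0 zS.
  exact: rpred1.
have [e [Ee eP]] : exists e, E (g *+ m, e) /\
    ~ is_int ((lincomb w r f)%:~R / k%:R - e / m%:R).
  have [h|h] := pselect (is_int ((lincomb w r f)%:~R / k%:R - q / m%:R)); last by exists q.
  exists (q + 1); split=> // h'; have := rpredB h h'.
  have -> : (lincomb w r f)%:~R / k%:R - q / m%:R - ((lincomb w r f)%:~R / k%:R - (q + 1) / m%:R)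
     = m%:R^-1 :> rat by ring.
  by move/(int_invn m0) => m1'; rewrite m1' in m1.
exists (adjoin E (g, e / m%:R)); split.
- split=> [|_ [v Ev [j ->]]|u Su iu|].
  + exact: mP.
  + by apply: (zsubD zP); [exact: EPC|rewrite pair_mulrz; exact: zsubMz].
  + by apply: adjoin_sub; exact: Espan.
  + exists (M * k)%N; first by rewrite muln_gt0 M0.
    move=> _ [v Ev [j ->]]; rewrite pair_mulrz /= mulrnDl; apply: (zsubD zS).
      by rewrite mulrnA; apply: (zsubMn zS); exact: EM.
    rewrite mulnC mulrnA; apply: (zsubMn zS).
    rewrite [g *~ j *+ k]pmulrn -mulrzA mulrC mulrzA -pmulrn; apply: (zsubMz zS).
    by exists b, f.
- exact: adjoin_sub.
- exists g, (e / m%:R), k, b, f; split=> //; exact: adjoin_mem pE.1.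
Qed.

(* A pure closure that is not finitely generated over its base carries a
   homomorphism to Q / Z, trivial on the base, that differs from the reduction
   of each of the countably many candidate homomorphisms to Q. *)
Lemma diagonal_hom : exists E : G * rat -> Prop,
  [/\ partial_hom is_int E, forall g q, E (g, q) -> PC g,
      forall g q, span g -> is_int q -> E (g, q) & forall w, avoids E w].
Proof.
have zS : zsub span by exact: zsub_span.
pose st := {E | bounded_hom E}.
have step (x : st * (nat -> int)) : exists E' : st,
    sval x.1 `<=` sval E' /\ avoids (sval E') x.2.
  case: x => -[E iE] w /=; have [E' [iE' EE' av]] := avoid_step w iE.
  by exists (exist _ E' iE').
have [F FP] := choice step.
have i0 : bounded_hom (fun u => span u.1 /\ is_int u.2).
  split=> [|u [Su _]|u Su iu|].
  - split; last by move=> q [].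
    split=> [|x y [Sx ix] [Sy iy]]; first by split; [exact: zsub0|exact: rpred0].
    by split; [exact: zsubB|exact: rpredB].
  - exact: span_pure.
  - by split.
  - by exists 1%N => // u [].
pose W k : nat -> int := nth 0 (odflt [::] (unpickle k : option (seq int))).
pose chain := fix chain k := if k is k'.+1 then F (chain k', W k') else exist _ _ i0.
pose E k := sval (chain k).
have Ei k : bounded_hom (E k) by exact: svalP (chain k).
have Esub k l : (k <= l)%N -> E k `<=` E l.
  move=> /subnK <-; elim: (l - k)%N => // j IH.
  by apply: (subset_trans IH); exact: (FP (chain _, W _)).1.
exists (fun u => exists k, E k u); split.
- split; first split.
  + by exists 0%N; split; [exact: zsub0|exact: rpred0].
  + move=> x y [k Ex] [l Ey]; exists (maxn k l).
    have [[[_ H] _] _ _ _] := Ei (maxn k l).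
    by apply: H; [apply: Esub Ex; exact: leq_maxl|apply: Esub Ey; exact: leq_maxr].
  + by move=> q [k]; have [[_ H] _ _ _] := Ei k; exact: H.
- by move=> g q [k Ek]; have [_ H _ _] := Ei k; exact: (H (g, q)).
- by move=> g q Sg iq; exists 0%N; split.
- move=> w; pose k := pickle (mkseq w r).
  have [g [q [m [b [f [Egq m0 Bb gm nz]]]]]] := (FP (chain k, W k)).2.
  exists g, q, m, b, f; split=> //; first by exists k.+1.
  suff <- : lincomb (W k) r f = lincomb w r f by [].
  by apply: eq_bigr => i _; rewrite /W pickleK /= nth_mkseq.
Qed.

End Diagonal.

Lemma additive_lincomb (G H : zmodType) (psi : {additive G -> H}) c r f :
  psi (lincomb c r f) = lincomb (psi \o c) r f.
Proof. by rewrite raddf_sum; apply: eq_bigr => i _; rewrite raddfMz. Qed.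

Lemma intr_lincomb (w : nat -> int) r f :
  (lincomb w r f)%:~R = lincomb (fun i => (w i)%:~R : rat) r f.
Proof. by rewrite rmorph_sum /=; apply: eq_bigr => i _; rewrite mulrzz intrM mulrzr. Qed.

(** If [g] had finite order m > 1, the homomorphism to Q / Z with value 1 / m at [g] could not lift,
    since Q has no torsion. *)
Lemma whitehead_torsion_free (G : zmodType) : whitehead G -> torsion_free G.
Proof.
move=> wG g k k0 gk; pose E (u : G * rat) := u.1 = 0 /\ is_int u.2.
have pE : partial_hom is_int E.
  split; last by move=> q [].
  split=> [|x y [x0 ix] [y0 iy]]; first by split; [|exact: rpred0].
  by split; [rewrite /= x0 y0 subrr|exact: rpredB].
have [|m [m0 [_ [/= gm _]] mP]] := partial_hom_adjoin_root zsub_int pE (g := g).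
  by exists k => //; exists 0; split; [|exact: rpred0].
have E1 : E (g *+ m, 1) by split; [|exact: rpred1].
have [psi psiE] := whitehead_extend wG (mP _ E1).
have mn0 : m%:R != 0 :> rat by rewrite pnatr_eq0 -lt0n.
have pg0 : psi g = 0.
  have := raddfMn psi m g; rewrite gm raddf0 -mulr_natr => /esym /eqP.
  by rewrite mulf_eq0 (negPf mn0) orbF => /eqP.
have := psiE g (1 / m%:R) (adjoin_mem _ pE.1).
rewrite pg0 sub0r div1r /is_int rpredN => /(int_invn m0) m1.
by rewrite -(mulr1n g) -m1.
Qed.

(** A countable subgroup that is not free contains an unbounded tuple, by Pontryagin's criterion. A
    lift of the diagonal homomorphism over the zero subgroup takes integer values on the tuple, but
    all integer values have been avoided. *)
Lemma whitehead_aleph1_free (G : zmodType) : whitehead G -> aleph1_free G.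
Proof.
move=> wG S cS; have tf := whitehead_torsion_free wG.
have tfS : torsion_free (subgrp S).
  by move=> x m m0 /(congr1 val); rewrite raddfMn raddf0 => /(tf _ _ m0) x0; exact: val_inj.
have [c csurj] : exists c : nat -> subgrp S, forall g, exists n, c n = g.
  have /countable_injP[h hinj] := cS.
  exists (fun n => xget 0 [set g | h (val g) = n]) => g; exists (h (val g)).
  have /= := xgetPex 0 (ex_intro (fun x : subgrp S => h (val x) = h (val g)) g erefl).
  move=> /hinj E; apply: val_inj; apply: E; apply/mem_set => /=; exact: subgrp_valP.
apply: (pontryagin tfS csurj) => n ubd.
pose triv (x : G) := x = 0.
have ztriv : zsub triv by split=> // x y -> ->; rewrite /triv subrr.
pose d := val \o c.
have spanE f : val (lincomb c n f) = lincomb d n f by rewrite additive_lincomb.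
have ubd' : unbounded_span triv d n.
  move=> M M0; have [g [m m0 [_ [f [-> gm]]]] nMg] := ubd M M0.
  exists (val g).
    exists m => //; exists 0, f; split=> //.
    by rewrite add0r -spanE -[lincomb c n f]add0r -gm raddfMn.
  move=> [_ [f' [-> gM]]]; apply: nMg; exists 0, f'; split=> //.
  by apply: val_inj; rewrite raddfMn gM !add0r; exact/esym/spanE.
have [E [pE _ Espan Eav]] := diagonal_hom ztriv ubd'.
have [psi psiE] := whitehead_extend wG pE.
have psid i : (i < n)%N -> exists z : int, psi (d i) = z%:~R.
  move=> ilt; apply/intrP; rewrite -[psi _]subr0; apply: psiE.
  by apply: Espan; [exact: mem_span|exact: rpred0].
have psid' i : exists z : int, (i < n)%N -> psi (d i) = z%:~R.
  by have [/psid[z]|] := ltnP i n; [exists z|exists 0].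
have [w wE] := choice psid'.
have [g [q [m [_ [f [Egq m0 -> gm nz]]]]]] := Eav w.
apply: nz; suff -> : (lincomb w n f)%:~R / m%:R = psi g by exact: psiE.
have mn0 : m%:R != 0 :> rat by rewrite pnatr_eq0 -lt0n.
apply: (mulIf mn0); rewrite divfK // mulr_natr -raddfMn gm add0r.
by rewrite intr_lincomb additive_lincomb; apply: eq_bigr => i _ /=; rewrite wE.
Qed.

(** * Independent tuples in a Whitehead group that is not a Shelah group *)

Lemma subgrp_quot_map (G : zmodType) (B C : zmodClosed G) :
  exists pi : {additive subgrp C -> subgrp_quot C B},
    (forall y, exists x, pi x = y) /\ forall x, pi x = 0 <-> val x \in B.
Proof.
pose J := GRing.ZmodClosed.clone (subgrp C) (@relative _ B C) _.
exists (\pi_(Quotient.quot J) : {additive _ -> _}); split.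
  by move=> y; exists (repr y); rewrite /= reprK.
move=> x /=; have H : (\pi_(Quotient.quot J) x = \pi_(Quotient.quot J) 0) <-> val x \in B.
  split=> [/eqP|xB].
    by rewrite -Quotient.idealrBE subr0.
  by apply/eqP; rewrite -Quotient.idealrBE subr0.
by rewrite -H; have -> : \pi_(Quotient.quot J) 0 = 0 by exact: raddf0.
Qed.

Section Branch.

(* Initial segments are listed backwards, so that recursion on the list walks
   down the tree to its root. *)
Fixpoint branch (a : nat -> bool) (n : nat) : seq bool :=
  if n is n'.+1 then a n' :: branch a n' else [::].

Lemma size_branch a n : size (branch a n) = n.
Proof. by elim: n => //= n ->. Qed.

Lemma branch_inj a b n : branch a n = branch b n -> {in gtn n, a =1 b}.
Proof.
elim: n => // n IH /= [ab /IH H] j; rewrite inE ltnS leq_eqVlt.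
by case/orP=> [/eqP ->//|jn]; exact: H.
Qed.

(* Every subset of { a i } is relatively F_sigma: { a i } is a Q-set. *)
Definition q_family (I : Type) (a : I -> nat -> bool) : Prop :=
  forall P : I -> Prop, exists R : nat -> seq bool -> Prop,
    forall i, P i <-> exists w, forall n, R w (branch (a i) n).

End Branch.

(** * Countable pure hulls *)

Section Hull.
Variable G : zmodType.
Hypothesis tf : torsion_free G.

Lemma enum_countable (P : G -> Prop) : countable [set x | P x] -> P 0 ->
  exists b : nat -> G, (forall n, P (b n)) /\ forall x, P x -> exists n, b n = x.
Proof.
move=> /countable_injP[h hinj] P0.
exists (fun n => xget 0 [set x | P x /\ h x = n]); split.
  by move=> n; case: xgetP => // x -> [].
move=> x Px; exists (h x).
have [Py hy] := xgetPex 0 (ex_intro (fun y => P y /\ h y = h x) x (conj Px erefl)).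
by apply: hinj => //; apply/mem_set.
Qed.

Let triv (x : G) : Prop := x = 0.

Let ztriv : zsub triv.
Proof. by split=> // x y -> ->; rewrite /triv subrr. Qed.

Definition hull (y : nat -> G) (g : G) : Prop := exists n, pure_span triv y n g.

Fact pure_span_le y n k g : (n <= k)%N -> pure_span triv y n g -> pure_span triv y k g.
Proof.
move=> nk [m m0 [b [f [b0 E]]]]; exists m => //.
exists b, (fun i => if (i < n)%N then f i else 0); split=> //; rewrite E; congr (_ + _).
rewrite /lincomb (big_ord_widen k (fun i => y i *~ f i)) // big_mkcond /=.
by apply: eq_bigr => i _; case: ifP; rewrite ?mulr0z.
Qed.

Lemma zsub_hull y : zsub (hull y).
Proof.
split=> [|g h [n gn] [k hk]]; first by exists 0%N; exact: zsub0 (zsub_pure_span _ _ _).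
exists (maxn n k); apply: (zsubB (zsub_pure_span ztriv _ _)).
  by apply: pure_span_le gn; exact: leq_maxl.
by apply: pure_span_le hk; exact: leq_maxr.
Qed.

Lemma hull_mem y n : hull y (y n).
Proof. by exists n.+1; apply/span_pure/mem_span. Qed.

Lemma hull_root y g m : (0 < m)%N -> hull y (g *+ m) -> hull y g.
Proof. by move=> m0 [n /(pure_span_root m0) H]; exists n. Qed.

Lemma hull_min y (S : G -> Prop) : zsub S -> (forall n, S (y n)) ->
  forall g, hull y g -> exists2 m, (0 < m)%N & S (g *+ m).
Proof.
move=> zS Sy g [n [m m0 [b [f [-> E]]]]]; exists m => //; rewrite E add0r.
by apply: zsub_sum => // i _; exact: zsubMz.
Qed.

Lemma countable_hull y : countable [set g | hull y g].
Proof.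
pose S g : set (nat * nat * seq int) :=
  [set u | (0 < u.1.2)%N /\ g *+ u.1.2 = lincomb y u.1.1 (nth 0 u.2)].
have SP g : hull y g -> exists u, S g u.
  move=> [n [m m0 [b [f [-> E]]]]]; exists (n, m, mkseq f n); split=> //=.
  rewrite E add0r; apply: eq_lincomb => i; rewrite inE => ilt.
  by rewrite nth_mkseq.
apply/countable_injP; exists (fun g => pickle (xget (0%N, 0%N, [::]) (S g))).
move=> g h /set_mem /SP Sg /set_mem /SP Sh /(pcan_inj pickleK) E.
have [m0 gE] := xgetPex (0%N, 0%N, [::]) Sg.
have [_ hE] := xgetPex (0%N, 0%N, [::]) Sh.
by apply: (torsion_free_inj tf m0); rewrite gE [in RHS]E hE E.
Qed.

End Hull.

Section Family.
Variable G : zmodType.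
Hypothesis tf : torsion_free G.
Variables (B : G -> Prop).
Hypothesis zB : zsub B.
Hypothesis pureB : forall g m, (0 < m)%N -> B (g *+ m) -> B g.

Definition tuple_pure (t : seq G) : G -> Prop := pure_span B (nth 0 t) (size t).
Definition tuple_unbounded (t : seq G) : Prop :=
  unbounded_span B (nth 0 t) (size t).

(** The sum of the pure closures modulo [B] is direct, so homomorphisms vanishing on [B] can be
    prescribed on them separately. *)
Definition indep_family (T : set (seq G)) : Prop :=
  forall (l : seq (seq G)) (x : seq G -> G), uniq l -> {in l, forall t, T t} ->
    {in l, forall t, tuple_pure t (x t)} -> B (\sum_(t <- l) x t) ->
    {in l, forall t, B (x t)}.

Lemma maximal_indep_family : exists T : set (seq G),
  [/\ forall t, T t -> tuple_unbounded t, indep_family T &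
      forall t, tuple_unbounded t -> indep_family (T `|` [set t]) -> T t].
Proof.
pose P T := (forall t, T t -> tuple_unbounded t) /\ indep_family T.
have [|T [[TN TI] Tmax]] := @Zorn_bigcup _ P.
  move=> F FP Ftot; split; first by move=> t [X FX Xt]; exact: (FP X FX).1.
  move=> l x ul lF.
  have [->//|[X FX lX]] : l = [::] \/ exists2 X, F X & {in l, forall t, X t}.
    elim: l lF {ul} => [|t l IH] lF; first by left.
    right; have [X FX Xt] := lF t (mem_head _ _).
    have [|->|[Y FY lY]] := IH; first by move=> s sl; apply: lF; rewrite inE sl orbT.
      by exists X => // s; rewrite inE => /eqP ->.
    have [XY|YX] := Ftot _ _ FX FY.
      by exists Y => // s; rewrite inE => /orP[/eqP ->|/lY//]; exact: XY.
    by exists X => // s; rewrite inE => /orP[/eqP ->//|/lY/YX].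
  by apply: (FP X FX).2.
exists T; split=> // t tN tI; apply: contrapT => nTt; apply: (Tmax (T `|` [set t])).
  by split=> [s Ts|/(_ t)]; [left|move/(_ (or_intror erefl))].
by split=> // s [/TN//|->].
Qed.

End Family.

(** Take a maximal [T]. Were it countable, a countable pure [B'] would contain [B] and all entries
    of [T], and the [C] refuting the Shelah property at [B'] would yield an unbounded tuple in [C].
    As [C] meets [B'] only in [B0], this tuple is independent of [T], so it belongs to [T] by
    maximality. Then its entries lie in [B'], hence in [B0], and it cannot be unbounded. *)
Lemma uncountable_family (G : zmodType) : whitehead G -> cardinality_aleph1 G ->
  ~ shelah_group G ->
  exists (B : G -> Prop) (b : nat -> G) (T : set (seq G)),
    [/\ zsub B, (forall n, B (b n)) /\ (forall x, B x -> exists n, b n = x),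
        forall t, T t -> tuple_unbounded B t, indep_family B T & ~ countable T].
Proof.
move=> wG cG nsh; have tf := whitehead_torsion_free wG.
have [B0 cB0 B0P] : exists2 B0 : zmodClosed G, countable_subgrp B0 &
    forall B' : zmodClosed G, countable_subgrp B' -> (forall x, x \in B0 -> x \in B') ->
    exists C : zmodClosed G, [/\ countable_subgrp C,
      forall x, (x \in C /\ x \in B') <-> x \in B0 & ~ free_group (subgrp_quot C B0)].
  apply: contrapT => H; apply: nsh; split=> //; first exact: whitehead_aleph1_free.
  move=> B cB; apply: contrapT => H'; apply: H; exists B => // B' cB' BB'.
  apply: contrapT => H''; apply: H'; exists B'; split=> // C cC CB'.
  by apply: contrapT => nf; apply: H''; exists C.
have [b0 [b0B b0P]] := enum_countable cB0 (rpred0 B0).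
(* [B0] may fail to be pure. Passing to its hull is harmless: [B] will lie in [B'], so [C] meets it
   only in [B0]. *)
pose B := hull b0.
have zB : zsub B by exact: zsub_hull.
have B0B x : x \in B0 -> B x by move=> /b0P[n <-]; exact: hull_mem.
have pureB g m : (0 < m)%N -> B (g *+ m) -> B g by exact: hull_root.
have BB0 g : B g -> exists2 m, (0 < m)%N & g *+ m \in B0.
  apply: (@hull_min G b0 (fun x => x \in B0)) => //; split; first exact: rpred0.
  by move=> x y; exact: rpredB.
have [b [bB bP]] := enum_countable (countable_hull tf b0) (zsub0 zB).
have [T [TN TI Tmax]] := maximal_indep_family B.
exists B, b, T; split=> // cT.
pose Y := [set x | B x] `|` \bigcup_(t in T) [set` t].
have cY : countable Y.
  rewrite /Y -bigcup2E; apply: bigcup_countable => //.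
  move=> [|[|i]] _ /=; first exact: countable_hull.
    by apply: bigcup_countable => // t _; exact/finite_set_countable/finite_seq.
  exact: countable0.
have [y [yY yP]] := enum_countable cY (or_introl (zsub0 zB)).
have zB' := zsub_hull y.
pose B' := zsub_closed zB'.
have B'P x : x \in B' <-> hull y x by split=> [/zsub_closedP|hx]; [|exact/zsub_closedP].
have BB' x : B x -> hull y x by move=> Bx; have [|n <-] := yP x; [left|exact: hull_mem].
have TB' t x : T t -> x \in t -> hull y x.
  by move=> Tt xt; have [|n <-] := yP x; [right; exists t|exact: hull_mem].
have [||C [cC CB' nfree]] := B0P B'.
- rewrite /countable_subgrp (_ : [set x | _] = [set x | hull y x]); first exact: countable_hull.
  by apply/seteqP; split=> x /B'P.
- by move=> x /B0B/BB'/B'P.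
have [pi [pisurj piK]] := subgrp_quot_map B0 C.
have CB x : x \in C -> B x -> x \in B0.
  by move=> xC Bx; apply/CB'; split=> //; exact/B'P/BB'.
have tfQ : torsion_free (subgrp_quot C B0).
  move=> q m m0; have [x <-] := pisurj q; rewrite -raddfMn => /piK.
  rewrite raddfMn => xm; apply/piK; apply: CB; first exact: subgrp_valP.
  by apply: (pureB _ m) => //; exact: B0B.
have [c csurj] : exists c : nat -> subgrp_quot C B0, forall g, exists n, c n = g.
  have [e [eC eP]] := enum_countable cC (rpred0 C).
  exists (fun n => pi (Subgrp (eC n))) => q; have [x <-] := pisurj q.
  have [n en] := eP _ (subgrp_valP x); exists n; congr (pi _); exact: val_inj.
have [n ubd] : exists n, unbounded_span (fun x => x = 0) c n.
  by apply: contrapT => H; apply/nfree/(pontryagin tfQ csurj) => n ubd; apply: H; exists n.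
have [c' c'P] := choice (fun i => pisurj (c i)).
have piE f : pi (lincomb c' n f) = lincomb c n f.
  by rewrite additive_lincomb; apply: eq_bigr => i _ /=; rewrite c'P.
pose t := mkseq (fun i => val (c' i)) n.
have tE f : lincomb (nth 0 t) (size t) f = val (lincomb c' n f).
  rewrite additive_lincomb size_mkseq; apply: eq_bigr => i _ /=.
  by rewrite nth_mkseq.
have tC x : x \in t -> x \in C by move=> /mapP[i _ ->]; exact: subgrp_valP.
have tN : tuple_unbounded B t.
  move=> M M0; have [q [m m0 [_ [f [-> qm]]]] nMq] := ubd M M0.
  have [x xq] := pisurj q; exists (val x).
    exists m => //; exists (val x *+ m - lincomb (nth 0 t) (size t) f), f.
    split; last by rewrite subrK.
    apply: B0B; rewrite tE -raddfMn -raddfB; apply/piK.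
    by rewrite raddfB raddfMn xq qm piE add0r subrr.
  move=> [b1 [f' [Bb1 xM]]]; apply: nMq; exists 0, f'; split=> //.
  rewrite add0r -piE -xq -raddfMn; apply/eqP; rewrite -subr_eq0 -raddfB; apply/eqP/piK.
  apply: CB; first exact: subgrp_valP.
  by rewrite raddfB raddfMn xM tE addrK.
(* In m g = b1 + (combination of [t]), the combination lies in [C] and in [B'], hence in [B0];
   purity of [B] does the rest. *)
have key g : tuple_pure B t g -> hull y g -> B g.
  move=> [m m0 [b1 [f [Bb1 gm]]]] hg; apply: (pureB _ m) => //; rewrite gm.
  apply: (zsubD zB) => //; apply: B0B; apply/CB'; rewrite tE; split; first exact: subgrp_valP.
  apply/B'P; rewrite -tE -[lincomb _ _ _](addKr b1) addrC -gm.
  by apply: zsubB => //; [exact: zsubMn|exact: BB'].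
have Tt : T t.
  apply: Tmax => // l x ul lT lx lB.
  have [tl|tl] := boolP (t \in l); last first.
    apply: TI => // s sl; have [//|/= st] := lT s sl; by rewrite -st sl in tl.
  have remT : {in rem t l, forall s, T s}.
    move=> s; rewrite mem_rem_uniq // !inE => /andP[/eqP st sl].
    by have [//|/= ] := lT s sl.
  have reml : {in rem t l, forall s, tuple_pure B s (x s)}.
    by move=> s /mem_rem; exact: lx.
  rewrite (perm_big _ (perm_to_rem tl)) /= big_cons in lB.
  have hrem : hull y (\sum_(s <- rem t l) x s).
    apply: zsub_sum => // s sl; have [m m0 [b1 [f [Bb1 E]]]] := reml s sl.
    apply: (hull_root m0); rewrite E; apply: zsubD => //; first exact: BB'.
    apply: zsub_sum => // i _; apply: zsubMz => //.
    by apply: (TB' s); [exact: remT|exact: mem_nth].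
  have Bt : B (x t).
    apply: key; first exact: lx.
    rewrite -(addrK (\sum_(s <- rem t l) x s) (x t)).
    by apply: zsubB => //; exact: BB'.
  have Brem : B (\sum_(s <- rem t l) x s).
    by rewrite -(addKr (x t) (\sum_(s <- _) _)); apply: zsubD => //; exact: zsubN.
  move=> s sl; have [->//|st] := eqVneq s t.
  apply: (TI (rem t l)) => //; first exact: rem_uniq.
  by rewrite mem_rem_uniq // !inE st.
have [g [m m0 [b1 [f [Bb1 gm]]]] []] := tN 1%N isT.
apply: base_span; rewrite mulr1n; apply: (pureB _ m) => //; rewrite gm.
apply: zsubD => //; apply: zsub_sum => // i _; apply: zsubMz => //; apply: B0B.
apply/CB'; have ti := mem_nth 0 (ltn_ord i); split; first exact: tC.
by apply/B'P; exact: TB' ti.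
Qed.

(** * A Q-set *)

Section Uniformize.
Variable G : zmodType.
Hypothesis wG : whitehead G.
Variables (B : G -> Prop) (b : nat -> G) (T : set (seq G)).
Hypotheses (zB : zsub B) (bB : forall n, B (b n)).
Hypothesis bP : forall x, B x -> exists n, b n = x.
Hypothesis TN : forall t, T t -> tuple_unbounded B t.
Hypothesis TI : indep_family B T.

Let lc (t : seq G) (f : nat -> int) : G := lincomb (nth 0 t) (size t) f.

(** As a 0-1 sequence in [j] this is the real coding [t]: it records which combinations of [t],
    shifted by elements of [B], are divisible by which m. *)
Definition relation_holds (t : seq G) (j : nat) : Prop :=
  if unpickle j is Some (m, k, n) then
    [/\ (0 < m)%N, size n = size t & exists g, g *+ m = b k + lc t (nth 0 n)]
  else False.

(** [phi k] stands for the value at [b k], and [w] for the values at the entries of [t]. *)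
Definition relation_solved (phi : nat -> rat) (w : seq int) (j : nat) : Prop :=
  if unpickle j is Some (m, k, n) then
    is_int ((phi k + (lincomb (nth 0 w) (size n) (nth 0 n))%:~R) / m%:R)
  else True.

(** Each closure gets its own homomorphism to Q / Z, zero if [P t] and diagonal otherwise, all of
    them zero on [B]. Independence merges them into one homomorphism on the sum of the closures,
    which is then extended and lifted. *)
Lemma prescribed_lift (P : seq G -> Prop) : exists psi : {additive G -> rat},
  [/\ forall x, B x -> is_int (psi x),
      forall t, T t -> forall g, span_mod B (nth 0 t) (size t) g -> is_int (psi g),
      forall t g, T t -> P t -> tuple_pure B t g -> is_int (psi g) &
      forall t, T t -> ~ P t -> forall w, exists g m x f,
        [/\ (0 < m)%N, B x, g *+ m = x + lc t f &
        ~ is_int ((lincomb w (size t) f)%:~R / m%:R - psi g)]].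
Proof.
have exE t : exists E : G * rat -> Prop, T t ->
  [/\ partial_hom is_int E, forall g q, E (g, q) -> tuple_pure B t g,
      forall g q, span_mod B (nth 0 t) (size t) g -> is_int q -> E (g, q),
      P t -> forall g, tuple_pure B t g -> E (g, 0) &
      ~ P t -> forall w, avoids B (nth 0 t) (size t) E w].
  have [Tt|nTt] := pselect (T t); last by exists xpredT => /nTt.
  have [Pt|nPt] := pselect (P t); last first.
    by have [E [? ? ? ?]] := diagonal_hom zB (TN Tt); exists E.
  have zP := zsub_pure_span zB (nth 0 t) (size t).
  exists (fun u => tuple_pure B t u.1 /\ is_int u.2) => _; split=> //.
  - split; last by move=> q [].
    split=> [|x y [Sx ix] [Sy iy]]; first by split; [exact: zsub0|exact: is_int0].
    by split; [exact: zsubB|exact: rpredB].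
  - by move=> g q [].
  - by move=> g q Sg iq; split=> //; exact: span_pure.
have {exE} [E EP] := choice exE.
have E0t t : T t -> E t 0 by move=> Tt; have [[[]]] := EP t Tt.
pose E0 (u : G * rat) := exists (l : seq (seq G)) (x : seq G -> G) (y : seq G -> rat) (z : G),
  [/\ uniq l, {in l, forall t, T t}, {in l, forall t, E t (x t, y t)}, B z &
      u.1 = z + \sum_(t <- l) x t /\ is_int (u.2 - \sum_(t <- l) y t)].
have widen (V : zmodType) (l l' : seq (seq G)) (x : seq G -> V) : uniq l -> uniq l' ->
    {subset l <= l'} ->
    \sum_(t <- l) x t = \sum_(t <- l') (if t \in l then x t else 0).
  move=> ul ul' ll'; rewrite -big_mkcond -big_filter /=; apply: perm_big.
  apply: uniq_perm => //; first exact: filter_uniq.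
  by move=> t; rewrite mem_filter; case: (boolP (t \in l)) => //= /ll' ->.
have pE0 : partial_hom is_int E0.
  split; first split.
  - exists [::], (fun=> 0), (fun=> 0), 0; rewrite !big_nil; split=> //; first exact: zsub0.
    by split; [rewrite addr0|rewrite /is_int subr0 rpred0].
  - move=> u v [l [x [y [z [ul lT lE Bz [u1 u2]]]]]] [l' [x' [y' [z' [ul' lT' lE' Bz' [v1 v2]]]]]].
    pose L := undup (l ++ l').
    have lL : {subset l <= L} by move=> t tl; rewrite mem_undup mem_cat tl.
    have lL' : {subset l' <= L} by move=> t tl; rewrite mem_undup mem_cat tl orbT.
    have uL : uniq L := undup_uniq _.
    have LT : {in L, forall t, T t}.
      by move=> t; rewrite mem_undup mem_cat => /orP[/lT|/lT'].
    exists L, (fun t => (if t \in l then x t else 0) - (if t \in l' then x' t else 0)),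
      (fun t => (if t \in l then y t else 0) - (if t \in l' then y' t else 0)), (z - z').
    split=> //; [|exact: zsubB|split].
    + move=> t tL; have Et0 := E0t t (LT t tL).
      have [[zE _] _ _ _ _] := EP t (LT t tL).
      apply: (zsubB zE (x := (_, _)) (y := (_, _))).
        by case: ifPn => [/lE//|_].
      by case: ifPn => [/lE'//|_].
    + by rewrite sumrB -!widen // /= u1 v1 opprD addrACA.
    + rewrite sumrB -!widen // /is_int /=.
      rewrite [X in X \is a _](_ : _ = (u.2 - \sum_(t <- l) y t) - (v.2 - \sum_(t <- l') y' t)).
        exact: rpredB.
      by rewrite !opprD !opprK addrACA.
  (* If the total is 0, independence puts every [x t] into [B], where [E t] takes only integer
     values. *)
  - move=> q [l [x [y [z [ul lT lE Bz [/= s0 iq]]]]]].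
    have sB : B (\sum_(t <- l) x t).
      have -> : \sum_(t <- l) x t = - z by apply/eqP; rewrite -addr_eq0 addrC -s0.
      exact: zsubN.
    have xB : {in l, forall t, B (x t)}.
      by apply: TI => // t tl; have [_ H _ _ _] := EP t (lT t tl); apply: H (lE t tl).
    rewrite -(subrK (\sum_(t <- l) y t) q); apply: rpredD => //.
    apply: (zsub_sum zsub_int) => t tl; have [[zE vE] _ H _ _] := EP t (lT t tl).
    apply: vE; have -> : (0, y t) = (x t, y t) - (x t, 0) by congr (_, _); rewrite /= ?subrr ?subr0.
    apply: zsubB => //; first exact: lE.
    by apply: H; [apply: base_span; exact: xB|exact: is_int0].
have [psi psiE] := whitehead_extend wG pE0.
have psiT t g q : T t -> E t (g, q) -> is_int (psi g - q).
  move=> Tt Eg; apply: psiE; exists [:: t], (fun=> g), (fun=> q), 0.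
  rewrite !big_seq1 add0r subrr; split=> //.
  - by move=> s; rewrite inE => /eqP ->.
  - by move=> s; rewrite inE => /eqP ->.
  - exact: zsub0.
exists psi; split.
- move=> x Bx; rewrite -[psi x]subr0; apply: psiE.
  exists [::], (fun=> 0), (fun=> 0), x; rewrite !big_nil; split=> //.
  by split; [rewrite addr0|rewrite /is_int subr0 rpred0].
- move=> t Tt g Sg; rewrite -[psi g]subr0; apply: (psiT t) => //.
  by have [_ _ H _ _] := EP t Tt; apply: H => //; exact: is_int0.
- move=> t g Tt Pt Sg; rewrite -[psi g]subr0; apply: (psiT t) => //.
  by have [_ _ _ H _] := EP t Tt; exact: H.
- move=> t Tt nPt w; have [_ _ _ _ H] := EP t Tt.
  have [g [q [m [x [f [Eg m0 Bx gm nz]]]]]] := H nPt w.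
  exists g, m, x, f; split=> // iz; apply: nz.
  by have := rpredD iz (psiT t g q Tt Eg); rewrite addrA subrK.
Qed.

(** A solution [w] extends psi restricted to [B] to an integer-valued homomorphism on the closure of
    [t]. If [P t], psi itself is one; otherwise the diagonal choice excludes every [w]. *)
Lemma relations_solvable (P : seq G -> Prop) :
  exists phi : nat -> rat, forall t, T t ->
    (P t <-> exists w, forall j, relation_holds t j -> relation_solved phi w j).
Proof.
have [psi [psiB psiS psiP psiN]] := prescribed_lift P.
exists (psi \o b) => t Tt.
have psit i : exists z : int, (i < size t)%N -> psi (nth 0 t i) = z%:~R.
  have [ti|] := ltnP i (size t); last by exists 0.
  by have /intrP[z zE] := psiS t Tt _ (mem_span zB (nth 0 t) ti); exists z.
have [v vE] := choice psit.
have psilc f : psi (lc t f) = (lincomb v (size t) f)%:~R.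
  by rewrite intr_lincomb additive_lincomb; apply: eq_bigr => i _ /=; rewrite vE.
split=> [Pt|[w sol]].
  exists (mkseq v (size t)) => j; rewrite /relation_holds /relation_solved.
  case: (unpickle j) => // -[[m k] n] [m0 sn [g gm]].
  rewrite [X in is_int X](_ : _ = psi g).
    by apply: (psiP t) => //; exists m => //; exists (b k), (nth 0 n).
  have mn0 : m%:R != 0 :> rat by rewrite pnatr_eq0 -lt0n.
  apply: (mulIf mn0); rewrite divfK // mulr_natr -raddfMn gm raddfD psilc /=.
  congr (_ + _%:~R); rewrite sn; apply: eq_bigr => i _.
  by rewrite nth_mkseq.
apply: contrapT => nPt.
(* The difference of psi and a solution vanishes on [B], has values [v i - nth 0 w i] on [t] and
   agrees with psi modulo Z: exactly what the diagonal homomorphism avoids. *)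
have [g [m [x [f [m0 Bx gm nz]]]]] := psiN t Tt nPt (fun i => v i - nth 0 w i).
have [k kx] := bP Bx; pose n := mkseq f (size t).
have nE (V : zmodType) (c : nat -> V) :
    lincomb c (size n) (nth 0 n) = lincomb c (size t) f.
  rewrite size_mkseq; apply: eq_lincomb => i; rewrite inE => it.
  by rewrite nth_mkseq.
have := sol (pickle (m, k, n)); rewrite /relation_holds /relation_solved pickleK => H.
have {}H : is_int (((psi \o b) k + (lincomb (nth 0 w) (size n) (nth 0 n))%:~R) / m%:R).
  apply: H; split=> //; first by rewrite size_mkseq.
  by exists g; rewrite gm kx /lc -nE size_mkseq.
apply: nz; rewrite nE /= kx in H.
have mn0 : m%:R != 0 :> rat by rewrite pnatr_eq0 -lt0n.
set L := lincomb _ _ _ in H *; set W := lincomb _ _ _.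
suff -> : W%:~R / m%:R - psi g = - ((psi x + L%:~R) / m%:R) by rewrite /is_int rpredN.
apply: (mulIf mn0); rewrite mulNr mulrBl !divfK // mulr_natr -raddfMn gm.
rewrite raddfD /= psilc; have -> : lincomb v (size t) f = W + L.
  by rewrite /W /L -big_split; apply: eq_bigr => i _; rewrite /= mulrzBl subrK.
rewrite intrD; ring.
Qed.

End Uniformize.

Theorem q_family_of_whitehead (G : zmodType) : whitehead G ->
  cardinality_aleph1 G -> ~ shelah_group G ->
  exists (I : choiceType) (a : I -> nat -> bool),
    ~ countable [set: I] /\ q_family a.
Proof.
move=> wG cG nsh.
have [B [b [T [zB [bB bP] TN TI cT]]]] := uncountable_family wG cG nsh.
pose I : choiceType := {t : seq G | `[< T t >]}.
have IT (i : I) : T (val i) by exact/asboolP/(valP i).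
pose a (i : I) j := `[< relation_holds b (val i) j >].
exists I, a; split.
  move=> /countable_injP[h hinj]; apply: cT; apply/countable_injP.
  pose h' t := if pselect (T t) is left Tt then h (exist _ t (asboolT Tt) : I) else 0%N.
  exists h' => s t /set_mem Ts /set_mem Tt; rewrite /h'.
  case: pselect => // Ts'; case: pselect => // Tt' /hinj H.
  by have /(congr1 val) := H (mem_set (A := setT) Logic.I) (mem_set (A := setT) Logic.I).
move=> P.
have [phi phiP] := relations_solvable wG zB bB bP TN TI (fun t => exists2 i : I, val i = t & P i).
pose W k : seq int := odflt [::] (unpickle k).
(* The bits of [s] are read off some [a i] passing through [s]. A node tests only the finitely many
   relations it knows, so the condition for fixed [w] is closed. *)
exists (fun w s => exists2 i, branch (a i) (size s) = s &
  forall j, (j < size s)%N -> a i j -> relation_solved phi (W w) j) => i.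
have -> : P i <-> exists2 i0 : I, val i0 = val i & P i0.
  by split=> [Pi|[i0 /val_inj ->//]]; exists i.
rewrite phiP //; split=> [[w sol]|[w sol]].
  exists (pickle w) => n; exists i; first by rewrite size_branch.
  by move=> j _ /asboolP; rewrite /W pickleK /=; exact: sol.
exists (W w) => j aj; have [i' bi sol'] := sol j.+1.
rewrite size_branch in bi sol'; apply: sol' => //.
by rewrite (branch_inj bi) ?inE //; exact/asboolP.
Qed.

(** * Monochromatic uniformization *)

Section EventualColor.
Variables (I : Type) (a : I -> nat -> bool).
Hypothesis aQ : q_family a.

Lemma q_family_inj i j : a i =1 a j -> i = j.
Proof.
move=> aij; have [R RP] := aQ (fun k => k = i).
have brE n : branch (a i) n = branch (a j) n by elim: n => //= n ->; rewrite aij.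
have [w Rw] := (RP i).1 erefl.
by apply/esym/RP; exists w => n; rewrite -brE.
Qed.

Lemma find_iota (P : pred nat) m j : (j < m)%N -> P j ->
  (forall k, (k < j)%N -> ~~ P k) -> find P (iota 0 m) = j.
Proof.
move=> jm Pj Pmin; set f := find _ _.
have hP : has P (iota 0 m) by apply/hasP; exists j; rewrite ?mem_iota.
have fm : (f < m)%N by rewrite -[X in (_ < X)%N](size_iota 0 m) -has_find.
apply/eqP; rewrite eqn_leq; apply/andP; split; rewrite leqNgt; apply/negP => lt.
  by have := before_find 0%N lt; rewrite nth_iota // Pj.
by have := Pmin _ lt; have := nth_find 0%N hP; rewrite nth_iota // add0n => ->.
Qed.

(* Each node guesses the colour of the least pair (colour, witness) that none of
   its initial segments refutes. *)
Lemma eventual_color (c : I -> nat) : exists F : seq bool -> nat,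
  forall i, exists n0, forall n, (n0 <= n)%N -> F (branch (a i) n) = c i.
Proof.
have [R RP] := choice (fun k => aQ (fun i => c i = k)).
pose dec j : nat * nat := odflt (0, 0)%N (unpickle j).
pose Rj j s := R (dec j).1 (dec j).2 s.
pose good := fix good j s : Prop := Rj j s /\ (if s is _ :: s' then good j s' else True).
have goodS j i n : good j (branch (a i) n.+1) -> good j (branch (a i) n) by case.
have goodW j i n k : (n <= k)%N -> good j (branch (a i) k) -> good j (branch (a i) n).
  by move=> /subnK <-; elim: (k - n)%N => // d IH /goodS.
have goodR j i : (forall n, good j (branch (a i) n)) <-> forall n, Rj j (branch (a i) n).
  split=> [H [|n]|H n]; [by case: (H 0%N)|by case: (H n.+1)|].
  by elim: n => [|n IH]; split=> //; [exact: (H 0%N)|exact: (H n.+1)].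
exists (fun s => (dec (find (fun j => `[< good j s >]) (iota 0 (size s).+1))).1) => i.
have ex : exists j, `[< forall n, good j (branch (a i) n) >].
  have [w Rw] := (RP (c i) i).1 erefl; exists (pickle (c i, w)).
  by apply/asboolP/goodR => n; rewrite /Rj /dec pickleK.
case: (ex_minnP ex) => j /asboolP jP jmin.
have jc : (dec j).1 = c i by apply/esym/RP; exists (dec j).2; exact/goodR.
have [N NP] : exists N, forall n, (N <= n)%N -> forall k, (k < j)%N -> ~ good k (branch (a i) n).
  have bad k : (k < j)%N -> exists n, ~ good k (branch (a i) n).
    move=> kj; apply: contrapT => H; have := jmin k; rewrite asboolT.
      by move/(_ isT); rewrite leqNgt kj.
    by move=> n; apply: contrapT => Hn; apply: H; exists n.
  elim: j bad {jP jmin jc} => [|j IH] bad; first by exists 0%N.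
  have [|N NP] := IH; first by move=> k kj; apply: bad; rewrite ltnS ltnW.
  have [n nP] := bad j (leqnn _); exists (maxn N n) => k.
  rewrite geq_max => /andP[Nk nk] l; rewrite ltnS leq_eqVlt => /orP[/eqP ->|]; last exact: NP.
  by move/(goodW _ _ _ _ nk).
(* A node of length n inspects only the codes up to n, so n must reach [j] besides refuting all
   smaller codes. *)
exists (maxn N j) => n; rewrite geq_max => /andP[Nn jn].
rewrite (@find_iota _ _ j) //; first by rewrite size_branch ltnS.
  exact/asboolP.
by move=> k kj; apply/asboolPn; exact: NP.
Qed.

End EventualColor.

(** * Arithmetic of Z[1/M] and of the localization at the primes of M *)

Section LocalIntegers.
Variable M : nat.
Hypothesis M0 : (0 < M)%N.

(* The rings Z[1/M], and M times the localization of Z at the primes of M. *)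
Definition away (q : rat) : Prop := exists k, is_int (q * M%:R ^+ k).
Definition local_mult (q : rat) : Prop :=
  exists c, [/\ (0 < c)%N, coprime c M & exists z : int, q * c%:R = M%:R * z%:~R].

Let Mn0 : M%:R != 0 :> rat. Proof. by rewrite pnatr_eq0 -lt0n. Qed.

Lemma is_int_nat (n : nat) : is_int n%:R. Proof. exact: rpred_nat. Qed.

Lemma zsub_away : zsub away.
Proof.
split=> [|x y [k xk] [l yl]]; first by exists 0%N; rewrite mul0r; exact: is_int0.
exists (k + l)%N; rewrite mulrBl; apply: rpredB.
  by rewrite exprD mulrA; apply: rpredM => //; apply: rpredX; exact: is_int_nat.
by rewrite addnC exprD mulrA; apply: rpredM => //; apply: rpredX; exact: is_int_nat.
Qed.

Lemma away_int q : is_int q -> away q.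
Proof. by move=> iq; exists 0%N; rewrite mulr1. Qed.

Lemma away_mulz q (z : int) : away q -> away (q * z%:~R).
Proof. by rewrite mulrzr; apply: zsubMz; exact: zsub_away. Qed.

Lemma away_div q d : (d %| M)%N -> away q -> away (q / d%:R).
Proof.
move=> /dvdnP[e Me] [k qk]; exists k.+1.
have d0 : d%:R != 0 :> rat by move: Mn0; rewrite Me natrM mulf_eq0 negb_or => /andP[].
have -> : q / d%:R * M%:R ^+ k.+1 = (q * M%:R ^+ k) * e%:R.
  by rewrite exprS {1}Me natrM; field.
by apply: rpredM => //; exact: is_int_nat.
Qed.

Lemma bezout_nat (c d : nat) : coprime c d ->
  exists u v : int, u * c%:Z + v * d%:Z = 1.
Proof.
move=> cd; have [u [v]] := Bezoutz c%:Z d%:Z.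
by rewrite /gcdz /= (eqP cd) => E; exists u, v.
Qed.

Lemma bezout_rat (c d : nat) : coprime c d ->
  exists u v : int, u%:~R * c%:R + v%:~R * d%:R = 1 :> rat.
Proof.
move=> /bezout_nat[u [v uv]]; exists u, v.
by rewrite -[c%:R]/(c%:Z%:~R) -[d%:R]/(d%:Z%:~R) -!intrM -intrD uv.
Qed.

(** The denominator of [q] divides both a power of M and a number prime to M. *)
Lemma away_local_int q c : coprime c M -> away q -> is_int (q * c%:R) -> is_int q.
Proof.
move=> cM [k qk] qc; have [|u [v uv]] := @bezout_rat c (M ^ k)%N.
  by rewrite coprimeXr.
rewrite /is_int -[q]mulr1 -uv mulrDr; apply: rpredD.
  by rewrite mulrCA; apply: rpredM => //; exact: intr_int.
by rewrite mulrCA natrX; apply: rpredM => //; exact: intr_int.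
Qed.

Lemma zsub_local_mult : zsub local_mult.
Proof.
split=> [|x y [c [c0 cM [z xE]]] [d [d0 dM [w yE]]]].
  by exists 1%N; rewrite coprime1n; split=> //; exists 0; rewrite mulr0 mul0r.
exists (c * d)%N; rewrite muln_gt0 c0 d0 coprimeMl cM dM; split=> //.
exists (z * d%:Z - w * c%:Z); rewrite intrB !intrM natrM -!pmulrn.
transitivity (x * c%:R * d%:R - y * d%:R * c%:R); first by ring.
by rewrite xE yE; ring.
Qed.

Lemma local_mult_div q c : (0 < c)%N -> coprime c M -> local_mult (q * c%:R) -> local_mult q.
Proof.
move=> c0 cM [d [d0 dM [z E]]]; exists (c * d)%N.
by rewrite muln_gt0 c0 d0 coprimeMl cM dM; split=> //; exists z; rewrite natrM mulrA.
Qed.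

Lemma local_multM (z : int) : local_mult (M%:R * z%:~R).
Proof. by exists 1%N; rewrite coprime1n; split=> //; exists z; rewrite mulr1. Qed.

(** Strong approximation. Write the denominator as [b1 * c], with [b1] dividing a power of M and [c]
    prime to M, and replace 1 / c by an inverse [u] of [c] modulo [b1 * M]; the factor M in this
    modulus makes the error a multiple of M. *)
Lemma away_approx q : exists2 q', away q' & local_mult (q' - q).
Proof.
have split_den b : (0 < b)%N -> exists b1 c k, [/\ b = (b1 * c)%N, coprime c M & (b1 %| M ^ k)%N].
  elim/ltn_ind: b => b IH b0; have [cb|ncb] := boolP (coprime b M).
    by exists 1%N, b, 0%N; rewrite mul1n.
  have g1 : (1 < gcdn b M)%N.
    by rewrite ltn_neqAle eq_sym ncb gcdn_gt0 b0.
  have [||b1 [c [k [bE cM bk]]]] := IH (b %/ gcdn b M)%N.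
  - by rewrite ltn_Pdiv.
  - by rewrite divn_gt0 ?(ltnW g1) //; apply: dvdn_leq => //; exact: dvdn_gcdl.
  exists (gcdn b M * b1)%N, c, k.+1; split=> //.
    by rewrite -mulnA -bE mulnC divnK // dvdn_gcdl.
  by rewrite expnS dvdn_mul // dvdn_gcdr.
have b0 : (0 < `|denq q|)%N by rewrite absz_gt0 denq_neq0.
have [b1 [c [k [bE cM bk]]]] := split_den _ b0.
have [b10 c0] : (0 < b1)%N /\ (0 < c)%N by move: b0; rewrite bE muln_gt0 => /andP[].
have qE : q = (numq q)%:~R / (b1%:R * c%:R).
  rewrite -natrM -bE -[LHS]divq_num_den; congr (_ / _).
  by rewrite -[in LHS]absz_denq.
have cMb : coprime c (b1 * M).
  by rewrite coprimeMr cM andbT (coprime_dvdr bk) // coprimeXr.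
have [u [v uv]] := bezout_rat cMb.
have b1n : b1%:R != 0 :> rat by rewrite pnatr_eq0 -lt0n.
have cn : c%:R != 0 :> rat by rewrite pnatr_eq0 -lt0n.
exists ((numq q)%:~R * u%:~R / b1%:R).
  have [e ME] := dvdnP bk; exists k; rewrite -natrX ME natrM.
  have -> : (numq q)%:~R * u%:~R / b1%:R * (e%:R * b1%:R) = (numq q)%:~R * u%:~R * e%:R :> rat by field.
  by apply: rpredM; [apply: rpredM; exact: intr_int|exact: is_int_nat].
exists c; split=> //; exists (- (numq q * v)).
rewrite [X in _ - X]qE mulrNz intrM; set A := (numq q)%:~R; rewrite mulrBl.
have -> : A * u%:~R / b1%:R * c%:R = A * (u%:~R * c%:R) / b1%:R by ring.
have -> : u%:~R * c%:R = 1 - v%:~R * (b1 * M)%:R :> rat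
  by apply/esym/eqP; rewrite subr_eq uv.
by rewrite natrM; field; apply/andP.
Qed.

Lemma solve_away (d D : nat) q : coprime d (D * M) -> (0 < d)%N -> away q ->
  exists t : int, away ((q + D%:R * t%:~R) / d%:R).
Proof.
move=> cdD d0 [k /intrP[z zE]].
have [|u [v uv]] := @bezout_rat d (M ^ k * D)%N.
  by move: cdD; rewrite !coprimeMr => /andP[-> dM]; rewrite coprimeXr.
exists (- (z * v)), k; have dn : d%:R != 0 :> rat by rewrite pnatr_eq0 -lt0n.
suff -> : (q + D%:R * (- (z * v))%:~R) / d%:R * M%:R ^+ k = z%:~R * u%:~R.
  by apply: rpredM; exact: intr_int.
have -> : z%:~R * u%:~R = z%:~R * (u%:~R * d%:R) / d%:R :> rat by field.
have -> : u%:~R * d%:R = 1 - v%:~R * (M ^ k * D)%:R :> rat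
  by apply/esym/eqP; rewrite subr_eq uv.
rewrite mulrNz intrM -zE natrM natrX; field.
by [].
Qed.

End LocalIntegers.

(** * Solving the congruences along the tree *)

Section TreeRecursion.
Variables (I : Type) (a : I -> nat -> bool) (p : nat -> nat) (M : nat).
Hypotheses (aQ : q_family a) (p_prime : forall n, prime (p n)) (p_inj : injective p).

Let ZM := away M.
Let zZM : zsub ZM := zsub_away M.

(** The square is there because vectors with coordinates in (1/M) Z will matter: changing a value by
    a multiple of M ^ 2 changes the homomorphism on them by multiples of M only. *)
Let M2 : rat := (M ^ 2)%:R.

Let awayM2 q (t : int) : ZM q -> ZM (q + M2 * t%:~R).
Proof.
move=> Zq; apply: (zsubD zZM) => //; apply: away_int.
by apply: rpredM; [exact: is_int_nat|exact: intr_int].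
Qed.

Lemma coprime_prime_prod n : coprime (p n) (\prod_(k < n) p k).
Proof.
apply: (big_ind (fun x => coprime (p n) x)) => [|x y cx cy|k _]; first exact: coprimen1.
  by rewrite coprimeMr cx.
rewrite prime_coprime // dvdn_prime2 //; apply/eqP => /p_inj E.
by have := ltn_ord k; rewrite -E ltnn.
Qed.

(** Each correction is a multiple of the earlier primes and so preserves their congruences. Primes
    dividing M are units in Z[1/M]. *)
Lemma chinese_away n c us : ZM c -> (forall k, ZM (us k)) ->
  exists t : int, forall k, (k < n)%N -> coprime (p k) M ->
    ZM ((c + M2 * t%:~R + us k) / (p k)%:R).
Proof.
move=> Zc Zus; elim: n => [|n [t tP]]; first by exists 0.
have [cn|ncn] := boolP (coprime (p n) M); last first.
  exists t => k; rewrite ltnS leq_eqVlt => /orP[/eqP ->|]; last exact: tP.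
  by rewrite (negPf ncn).
pose D := (M ^ 2 * \prod_(k < n) p k)%N.
have [|||s sP] := @solve_away M (p n) D (c + M2 * t%:~R + us n).
- by rewrite !coprimeMr cn coprime_prime_prod.
- exact: prime_gt0.
- by apply: (zsubD zZM) => //; exact: awayM2.
exists (t + (\prod_(k < n) p k)%N%:Z * s) => k.
have -> : c + M2 * (t + (\prod_(k < n) p k)%N%:Z * s)%:~R + us k =
    c + M2 * t%:~R + us k + D%:R * s%:~R.
  by rewrite /M2 /D intrD intrM natrM -[_%:Z%:~R]/((\prod_(k < n) p k)%N%:R); ring.
rewrite ltnS leq_eqVlt => /orP[/eqP -> //|kn] ck.
rewrite mulrDl; apply: (zsubD zZM); first exact: tP.
apply: away_int; rewrite /D (bigD1 (Ordinal kn)) //= mulnCA natrM.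
have pk0 : (p k)%:R != 0 :> rat by rewrite pnatr_eq0 -lt0n prime_gt0.
rewrite [X in is_int X](_ : _ = (M ^ 2 * \prod_(i < n | i != Ordinal kn) p i)%N%:R * s%:~R).
  by apply: rpredM; [exact: is_int_nat|exact: intr_int].
by field.
Qed.

Variables (F r : seq bool -> rat).
Hypotheses (ZF : forall s, ZM (F s)) (Zr : forall s, ZM (r s)).

(* The state of a node carries the value currently guessed for y and the values
   given to the nodes below.  When the guessed colour F changes, the guess is
   recomputed so as to fit all values already given. *)
Lemma tree_states : exists (v : seq bool -> rat) (u : seq bool -> rat),
  [/\ forall s, exists t : int, v s = F s + M2 * t%:~R,
      forall s, exists t : int, u s = r s + M2 * t%:~R,
      forall b s, F (b :: s) = F s -> v (b :: s) = v s &
      forall al n k, (k <= n)%N -> coprime (p k) M ->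
        ZM ((v (branch al n) + u (branch al k)) / (p k)%:R)].
Proof.
(* [crt] will adapt a new guess to the nodes already passed, [fit] a new node to the current
   guess. *)
have crtE (x : nat * rat * (nat -> rat)) : exists t : int,
    ZM x.1.2 -> (forall k, ZM (x.2 k)) -> forall k, (k < x.1.1)%N -> coprime (p k) M ->
    ZM ((x.1.2 + M2 * t%:~R + x.2 k) / (p k)%:R).
  case: x => -[n c] us /=.
  have [[Zc Zus]|nZ] := pselect (ZM c /\ forall k, ZM (us k)); last first.
    by exists 0 => Zc Zus; case: nZ.
  by have [t tP] := chinese_away n Zc Zus; exists t.
have [crt crtP] := choice crtE.
have fitE (x : nat * rat * rat) : exists t : int,
    ZM x.1.2 -> ZM x.2 -> coprime (p x.1.1) M ->
    ZM ((x.2 + (x.1.2 + M2 * t%:~R)) / (p x.1.1)%:R).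
  case: x => -[n q] v /=.
  have [[Zq [Zv cn]]|nZ] := pselect (ZM q /\ ZM v /\ coprime (p n) M); last first.
    by exists 0 => *; case: nZ.
  have [|||s sP] := @solve_away M (p n) (M ^ 2) (v + q).
  - by rewrite !coprimeMr cn.
  - exact: prime_gt0.
  - exact: (zsubD zZM).
  by exists s => _ _ _; rewrite addrA.
have [fit fitP] := choice fitE.
pose crt' n c us := c + M2 * (crt (n, c, us))%:~R.
pose fit' n q v := q + M2 * (fit (n, q, v))%:~R.
pose st := fix st (s : seq bool) : rat * (nat -> rat) :=
  if s is b :: s' then
    let v := if F s == F s' then (st s').1 else crt' (size s) (F s) (st s').2 in
    (v, fun k => if (k < size s)%N then (st s').2 k else fit' (size s) (r s) v)
  else (F s, fun=> fit' 0%N (r s) (F s)).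
have Inv s : [/\ exists t : int, (st s).1 = F s + M2 * t%:~R,
    forall k, ZM ((st s).2 k), exists t : int, (st s).2 (size s) = r s + M2 * t%:~R &
    forall k, (k <= size s)%N -> coprime (p k) M -> ZM (((st s).1 + (st s).2 k) / (p k)%:R)].
  elim: s => [|b s [[t vE] Zu _ uv]] /=.
    split.
    - by exists 0; rewrite mulr0 addr0.
    - by move=> k; exact: awayM2.
    - by exists (fit (0%N, r [::], F [::])).
    - by move=> k; rewrite leqn0 => /eqP -> c0; exact: (fitP (0%N, r [::], F [::]) (Zr _) (ZF _)).
  set v := if _ then _ else _.
  have vE' : exists t : int, v = F (b :: s) + M2 * t%:~R.
    rewrite /v; case: eqP => [->|_]; first by exists t.
    by exists (crt ((size s).+1, F (b :: s), (st s).2)).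
  have Zv : ZM v by case: vE' => t' ->; exact: awayM2.
  split=> //.
  - by move=> k; case: ifP => // _; exact: awayM2.
  - by rewrite ltnn; exists (fit ((size s).+1, r (b :: s), v)).
  move=> k; rewrite leq_eqVlt => /orP[/eqP -> ck|ks ck].
    by rewrite ltnn; exact: (fitP ((size s).+1, r (b :: s), v) (Zr _) Zv).
  rewrite ks /v; case: eqP => [_|_]; first exact: uv.
  exact: (crtP ((size s).+1, F (b :: s), (st s).2) (ZF _) Zu).
exists (fun s => (st s).1), (fun s => (st s).2 (size s)); split.
- by move=> s; case: (Inv s).
- by move=> s; case: (Inv s).
- by move=> b s /= ->; rewrite eqxx.
move=> al n k kn ck; have [_ _ _ /(_ k)] := Inv (branch al n).
rewrite size_branch => /(_ kn ck).
suff -> : (st (branch al n)).2 k = (st (branch al k)).2 k by rewrite size_branch.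
elim: n kn => [|n IH]; first by rewrite leqn0 => /eqP ->.
rewrite leq_eqVlt => /orP[/eqP ->//|kn].
by rewrite /= size_branch kn; exact: IH.
Qed.

End TreeRecursion.

(** The colour of [i] is the rational [r (inr i)]. Its guesses stabilise along the branch, and with
    them the states, whose limit is the value at [i]. Congruences at nodes before the stabilisation
    hold too, because every recomputed guess fits the nodes passed. *)
Lemma monochromatic_uniformization (I : Type) (a : I -> nat -> bool) (p : nat -> nat)
    (M : nat) (r : seq bool + I -> rat) :
  q_family a -> (forall n, prime (p n)) -> injective p ->
  (forall e, away M (r e)) ->
  exists r' : seq bool + I -> rat,
    (forall e, exists t : int, r' e = r e + (M ^ 2)%:R * t%:~R) /\
    forall i n, coprime (p n) M ->
      away M ((r' (inr i) + r' (inl (branch (a i) n))) / (p n)%:R).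
Proof.
move=> aQ p_prime p_inj Zr.
have [F0 F0P] := eventual_color aQ (fun i => pickle (r (inr i))).
(* Wrong guesses must also lie in Z[1/M] for the recursion to go on; 0 replaces those that do
   not. *)
pose F s : rat := let q := odflt 0 (unpickle (F0 s)) in if `[< away M q >] then q else 0.
have ZF s : away M (F s).
  by rewrite /F; case: asboolP => // _; exact: zsub0 (zsub_away M).
have FP i : exists n0, forall n, (n0 <= n)%N -> F (branch (a i) n) = r (inr i).
  have [n0 H] := F0P i; exists n0 => n /H; rewrite /F => ->.
  by rewrite pickleK /= asboolT.
have [v [u [vE uE vS vu]]] :=
  tree_states p_prime p_inj ZF (fun s => Zr (inl s)).
have [n0 n0P] := choice FP.
pose r' e := match e with inl s => u s | inr i => v (branch (a i) (n0 i)) end.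
exists r'; split=> [[s|i]|i n cn] /=; first exact: uE.
  by have [t ->] := vE (branch (a i) (n0 i)); exists t; rewrite n0P.
have vconst m : (n0 i <= m)%N -> v (branch (a i) m) = v (branch (a i) (n0 i)).
  move=> /subnK <-; elim: (m - n0 i)%N => // d IH; rewrite -IH addSn.
  by apply: vS; rewrite -/(branch (a i) (d + n0 i).+1) !n0P // ?leq_addl // -addSn leq_addl.
rewrite -(vconst (maxn n (n0 i))) ?leq_maxr //.
by apply: vu => //; exact: leq_maxl.
Qed.

(** * The group of a tree *)

Section FreeVect.
Variable J : choiceType.

Definition qspace : zmodType := {freeg J / rat}.

Definition basis (e : J) (q : rat) : qspace := << q *g e >>.
Definition qcoord (v : qspace) (e : J) : rat := coeff e v.
Definition eval (f : J -> rat) (v : qspace) : rat := fglift (f : J -> rat^o) v.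

Fact eval_morph f : zmod_morphism (eval f).
Proof. by move=> v w; apply (lift_is_additive (f : J -> rat^o) v w). Qed.

HB.instance Definition _ f :=
  GRing.isZmodMorphism.Build qspace rat (eval f) (eval_morph f).

Lemma eval_basis f e q : eval f (basis e q) = q * f e.
Proof. by apply (liftU (f : J -> rat^o)). Qed.

Lemma qcoordB v w e : qcoord (v - w) e = qcoord v e - qcoord w e.
Proof. by apply coeffB. Qed.

Lemma qcoordMn v n e : qcoord (v *+ n) e = qcoord v e *+ n.
Proof. by apply coeffMn. Qed.

Lemma qcoord0 e : qcoord 0 e = 0.
Proof. by apply coeff0. Qed.

Lemma qcoordD v w e : qcoord (v + w) e = qcoord v e + qcoord w e.
Proof. by apply coeffD. Qed.

Lemma qcoord_basis e q e' : qcoord (basis e q) e' = if e == e' then q else 0.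
Proof. by rewrite /qcoord coeffU; case: eqP; rewrite ?mulr1 ?mulr0. Qed.

Lemma basisB e q q' : basis e (q - q') = basis e q - basis e q'.
Proof. by rewrite /basis freegUB. Qed.

Fact basis_morph e : zmod_morphism (basis e).
Proof. exact: basisB. Qed.

HB.instance Definition _ e :=
  GRing.isZmodMorphism.Build rat qspace (basis e) (basis_morph e).

Lemma basis_sum v : v = \sum_(e <- dom v) basis e (qcoord v e).
Proof. by rewrite /basis freeg_sumE. Qed.

Lemma eval_sum f v : eval f v = \sum_(e <- dom v) qcoord v e * f e.
Proof. by rewrite {1}(basis_sum v) raddf_sum; apply: eq_bigr => e _; exact: eval_basis. Qed.

Lemma qcoord_inj v w : qcoord v =1 qcoord w -> v = w.
Proof. by move=> vw; apply/eqP/freeg_eqP => e; exact: vw. Qed.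

Lemma qspace_torsion_free : torsion_free qspace.
Proof.
move=> v m m0 vm; apply: qcoord_inj => e; rewrite qcoord0.
have := qcoordMn v m e; rewrite vm qcoord0 => /esym/eqP.
by rewrite mulrn_eq0 eqn0Ngt m0 => /eqP.
Qed.

End FreeVect.

Lemma torsion_free_mulrz (G : zmodType) (g : G) z : torsion_free G ->
  g <> 0 -> g *~ z = 0 -> z = 0.
Proof.
move=> tf g0; case: z => [[|n]|n] //; first by rewrite -pmulrn => /tf H; case: g0; exact: H.
rewrite NegzE -nmulrn => /eqP; rewrite oppr_eq0 => /eqP /tf H.
by case: g0; exact: H.
Qed.

Lemma additive_modMn (G : zmodType) (I : rat -> Prop) (Phi : G -> rat) g n : zsub I ->
  (forall g h, I (Phi (g - h) - (Phi g - Phi h))) -> I (Phi (g *+ n) - Phi g *+ n).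
Proof.
move=> zI PhiB; have Phi0 : I (Phi 0).
  by have := PhiB 0 0; rewrite !subrr subr0.
elim: n => [|n IH]; first by rewrite !mulr0n subr0.
have := zsubN zI (zsubB zI (PhiB (g *+ n + g) g) IH); rewrite addrK !mulrSr.
by congr I; ring.
Qed.

Section TreeGroup.
Variables (I : choiceType) (a : I -> nat -> bool) (p : nat -> nat).
Hypotheses (aQ : q_family a) (p_prime : forall n, prime (p n)) (p_inj : injective p).

Let J : choiceType := (seq bool + I)%type.
Let V := qspace J.

Definition node_gen (s : seq bool) : V := basis (inl s : J) 1.
Definition top_gen (i : I) : V := basis (inr i : J) 1.
Definition root_gen (i : I) (n : nat) : V :=
  basis (inr i : J) (p n)%:R^-1 + basis (inl (branch (a i) n) : J) (p n)%:R^-1.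

(* node_gen s is x_s, top_gen i is y_i and root_gen i n is
   (y_i + x_(a_i|n)) / p_n. *)
Definition tree_group (v : V) : Prop :=
  forall S : V -> Prop, zsub S -> (forall s, S (node_gen s)) ->
    (forall i, S (top_gen i)) -> (forall i n, S (root_gen i n)) -> S v.

Lemma zsub_tree_group : zsub tree_group.
Proof.
split=> [S zS *|v w Hv Hw S zS Sx Sy Sz]; first exact: zsub0.
by apply: zsubB => //; [exact: Hv|exact: Hw].
Qed.

Lemma coprime_p n M : coprime (p n) M \/ (p n %| M)%N.
Proof. by rewrite prime_coprime //; case: (p n %| M)%N; [right|left]. Qed.

(** A denominator [p n] of a generator either is prime to M, and is cleared by [c], or divides M. *)
Lemma tree_group_lattice M h : tree_group h -> (0 < M)%N ->
  exists c, [/\ (0 < c)%N, coprime c M & forall e, is_int (M%:R * qcoord (h *+ c) e)].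
Proof.
move=> Hh M0; apply: (Hh (fun h => exists c,
  [/\ (0 < c)%N, coprime c M & forall e, is_int (M%:R * qcoord (h *+ c) e)])).
- split=> [|v w [c [c0 cM vc]] [d [d0 dM wd]]].
    by exists 1%N; rewrite coprime1n; split=> // e; rewrite mul0rn qcoord0 mulr0; exact: is_int0.
  exists (c * d)%N; rewrite muln_gt0 c0 d0 coprimeMl cM dM; split=> // e.
  rewrite mulrnBl qcoordB mulrBr; apply: rpredB.
    by rewrite mulrnA qcoordMn mulrnAr; apply: rpredMn; exact: vc.
  by rewrite mulnC mulrnA qcoordMn mulrnAr; apply: rpredMn; exact: wd.
- move=> s; exists 1%N; rewrite coprime1n; split=> // e; rewrite mulr1n qcoord_basis.
  by case: eqP => _; rewrite ?mulr1 ?mulr0; [exact: is_int_nat|exact: is_int0].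
- move=> i; exists 1%N; rewrite coprime1n; split=> // e; rewrite mulr1n qcoord_basis.
  by case: eqP => _; rewrite ?mulr1 ?mulr0; [exact: is_int_nat|exact: is_int0].
move=> i n; have pn0 : (p n)%:R != 0 :> rat by rewrite pnatr_eq0 -lt0n prime_gt0.
have E e : exists k : nat, qcoord (root_gen i n) e = k%:R / (p n)%:R.
  rewrite qcoordD !qcoord_basis.
  by case: eqP => _; case: eqP => _; [exists 2|exists 1|exists 1|exists 0]; field.
have [cp|/dvdnP[d Md]] := coprime_p n M.
  exists (p n); split=> // [|e]; first exact: prime_gt0.
  have [k ->] : exists k : nat, qcoord (root_gen i n *+ p n) e = k%:R.
    by have [k kE] := E e; exists k; rewrite qcoordMn kE -[LHS]mulr_natr divfK.
  by apply: rpredM; exact: is_int_nat.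
exists 1%N; rewrite coprime1n; split=> // e; have [k kE] := E e.
rewrite mulr1n kE Md natrM [X in is_int X](_ : _ = d%:R * k%:R); last by field.
by apply: rpredM; exact: is_int_nat.
Qed.

(* Phi is a homomorphism to Q modulo M times the localization of Z at the primes
   of M, with Phi x = 1 and Phi integral at those primes on K.  It is lifted by
   taking values in Z[1/M] on the x_s and y_i; these are free modulo M ^ 2, and
   uniformization adjusts them to make the other primes p_n behave. *)
Lemma tree_group_hom (K : V -> Prop) (x : V) (M : nat) : zsub K ->
  (forall k, K k -> tree_group k) -> K x ->
  (forall d k, K k -> x = k *+ d -> d = 1%N) -> (0 < M)%N ->
  exists rho : {additive V -> rat},
    [/\ forall h, tree_group h -> away M (rho h), forall k, K k -> is_int (rho k) &
        exists j : int, rho x = 1 + M%:R * j%:~R].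
Proof.
move=> zK KH Kx xind M0; have tf := @qspace_torsion_free J.
have Mn0 : M%:R != 0 :> rat by rewrite pnatr_eq0 -lt0n.
have zI := zsub_local_mult M; have zA := zsub_away M.
(* This prescribes 1 at [x] and 0 on M K; the latter makes Phi integral on [K] at the primes of
   M. *)
pose E0 (u : V * rat) := exists (j : int) (k : V), K k /\ u = (x *~ j + k *+ M, j%:~R).
have pE0 : partial_hom (local_mult M) E0.
  split; first split.
  - by exists 0, 0; split; [exact: zsub0|rewrite mulr0z mul0rn addr0].
  - move=> _ _ [j [k [Kk ->]]] [j' [k' [Kk' ->]]]; exists (j - j'), (k - k').
    split; first exact: zsubB.
    by rewrite mulrzBr mulrnBl intrB; congr (_, _); rewrite /= opprD addrACA.
  move=> q [j [k [Kk [xk ->]]]].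
  (* From x j = - M k, Bezout makes d x equal to M times an element of [K]. So [x] is M / d times
     that element, and as it is no proper multiple in [K], M = d divides j. *)
  pose d := gcdn `|j|%N M; have d0 : (0 < d)%N by rewrite gcdn_gt0 M0 orbT.
  have [M' ME] : exists M', M = (M' * d)%N by apply/dvdnP; exact: dvdn_gcdr.
  have [u [v uv]] : exists u v : int, u * j + v * M%:Z = d%:Z.
    by have [u [v]] := Bezoutz j M%:Z; rewrite /gcdz /= => uv; exists u, v.
  have xE : x *+ d = (x *~ v - k *~ u) *+ M' *+ d.
    have xj : x *~ j = - (k *+ M) by apply/eqP; rewrite -addr_eq0 -xk.
    have uE : x *~ (u * j) = - (k *~ u *+ M).
      by rewrite mulrC mulrzA xj mulNrz [k *+ M]pmulrn [in RHS]pmulrn -!mulrzA mulrC.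
    have vE : x *~ (v * M%:Z) = x *~ v *+ M by rewrite mulrzA -pmulrn.
    by rewrite -mulrnA -ME mulrnBl addrC -uE -vE -mulrzDr uv.
  have M'1 : M' = 1%N.
    apply: (xind _ (x *~ v - k *~ u)); last exact: torsion_free_inj tf d0 xE.
    by apply: (zsubB zK); exact: zsubMz.
  have : (M %| `|j|)%N by rewrite ME M'1 mul1n dvdn_gcdl.
  move=> /dvdnP[z jz]; have [w jw] : exists w : int, j = M%:Z * w.
    exists (sgz j * z%:Z); rewrite [LHS]intEsg jz PoszM; ring.
  rewrite jw intrM -pmulrn; exact: local_multM.
have [Phi [PhiB PhiE]] := partial_hom_extend zI pE0.
(* Coordinates may be 1 / M at the primes of M, so Phi is approximated at that fraction of the basis
   vector. *)
have rE (e : J) : exists q, away M q /\ local_mult M (q / M%:R - Phi (basis e M%:R^-1)).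
  have [q Aq qI] := away_approx M (Phi (basis e M%:R^-1)).
  exists (q * M%:R); split; first by have := away_mulz M%:Z Aq; rewrite -pmulrn.
  by rewrite mulfK.
have [r rP] := choice rE.
have [r' [r'E r'A]] := monochromatic_uniformization aQ p_prime p_inj (fun e => (rP e).1).
have Ar' e : away M (r' e).
  have [t ->] := r'E e; apply: (zsubD zA); first exact: (rP e).1.
  by apply: away_int; apply: rpredM; [exact: is_int_nat|exact: intr_int].
pose S (v : V) := local_mult M (eval r' v - Phi v).
have zS : zsub S.
  have Phi0 : local_mult M (Phi 0) by have := PhiB 0 0; rewrite !subrr subr0.
  split=> [|v w Sv Sw]; rewrite /S; first by rewrite raddf0 sub0r; exact: zsubN.
  rewrite raddfB /=; have := zsubB zI (zsubB zI Sv Sw) (PhiB v w).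
  by congr (local_mult M _); ring.
have Sbasis e : S (basis e M%:R^-1).
  rewrite /S eval_basis; have [t ->] := r'E e.
  have := zsubD zI (rP e).2 (local_multM M t); congr (local_mult M _).
  by rewrite natrX; field.
have Slat v : (forall e, is_int (M%:R * qcoord v e)) -> S v.
  move=> iv; rewrite (basis_sum v); apply: zsub_sum => // e _.
  have /intrP[z zE] := iv e.
  have -> : basis e (qcoord v e) = basis e M%:R^-1 *~ z.
    by rewrite -raddfMz -mulrzr -zE mulrA mulVf // mul1r.
  exact: zsubMz.
have SH h : tree_group h -> S h.
  move=> Hh; have [c [c0 cM hc]] := tree_group_lattice Hh M0.
  apply: (local_mult_div c0 cM).
  have := zsubD zI (Slat _ hc) (additive_modMn h c zI PhiB).
  by congr (local_mult M _); rewrite raddfMn /= mulrBl !mulr_natr; ring.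
have AH h : tree_group h -> away M (eval r' h).
  move=> Hh; apply: (Hh (fun h => away M (eval r' h))).
  - by split=> [|v w Av Aw]; [rewrite raddf0; exact: zsub0|rewrite raddfB; exact: zsubB].
  - by move=> s; rewrite eval_basis mul1r.
  - by move=> i; rewrite eval_basis mul1r.
  move=> i n; rewrite raddfD /= !eval_basis -mulrDr mulrC.
  have [cp|dp] := coprime_p n M; first exact: r'A.
  by apply: away_div => //; exact: (zsubD zA).
have rhoK k : K k -> is_int (eval r' k).
  move=> Kk; have Hk := KH _ Kk.
  have E0k : E0 (k *+ M, 0) by exists 0, k; rewrite mulr0z add0r.
  have PhiM : local_mult M (Phi k * M%:R).
    have := zsubD zI (PhiE _ _ E0k) (additive_modMn k M zI PhiB).
    rewrite sub0r addrA addNr sub0r => /(zsubN zI); by rewrite opprK mulr_natr.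
  have [c [c0 cM [z zE]]] := SH k Hk; have [d [d0 dM [w wE]]] := PhiM.
  have wE' : Phi k * d%:R = w%:~R.
    by apply: (mulIf Mn0); rewrite mulrAC wE mulrC.
  apply: (@away_local_int M _ (c * d)%N); first by rewrite coprimeMl cM dM.
    exact: AH.
  rewrite [X in is_int X](_ : _ = M%:R * z%:~R * d%:R + w%:~R * c%:R).
    apply: rpredD; last by apply: rpredM; [exact: intr_int|exact: is_int_nat].
    by do 2?apply: rpredM; rewrite ?rpred_nat ?intr_int //.
  by rewrite -zE -wE' natrM; ring.
exists (eval r' : {additive V -> rat}); split=> //.
have [c [c0 cM [z zE]]] : local_mult M (eval r' x - 1).
  have E0x : E0 (x, 1) by exists 1, 0; rewrite mul0rn addr0 mulr1z; split=> //; exact: zsub0.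
  have := zsubB zI (SH x (KH _ Kx)) (PhiE _ _ E0x); congr (local_mult M _); ring.
have /intrP[y yE] : is_int (eval r' x - 1) by apply: rpredB; [exact: rhoK|exact: rpred1].
have [u [v uv]] := bezout_rat cM.
exists (u * z + v * y).
have E : eval r' x - 1 = M%:R * (u * z + v * y)%:~R.
  rewrite intrD !intrM; set A := eval r' x - 1 in zE yE *.
  transitivity ((A * c%:R) * u%:~R + A * v%:~R * M%:R); last by rewrite zE yE; ring.
  by rewrite -[LHS]mulr1 -[X in _ * X]uv; ring.
by rewrite -E /= addrC subrK.
Qed.

Let tf := @qspace_torsion_free J.

(* Homomorphisms to Z[1/2] and to Z[1/3] that do not vanish at x bound the odd
   part and the 2-part of a divisor of x. *)
Lemma tree_group_divisors x : tree_group x -> x <> 0 ->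
  exists D : nat, forall m y, tree_group y -> x = y *+ m -> (m <= D)%N.
Proof.
move=> Hx x0; pose K v := exists j : int, v = x *~ j.
have zK : zsub K.
  by split=> [|_ _ [i ->] [j ->]]; [exists 0; rewrite mulr0z|exists (i - j); rewrite mulrzBr].
have KH k : K k -> tree_group k by move=> [j ->]; exact: (zsubMz zsub_tree_group).
have Kx : K x by exists 1; rewrite mulr1z.
have xind d k : K k -> x = k *+ d -> d = 1%N.
  move=> [j ->] xE; have : x *~ (j * d%:Z - 1) = 0.
    by rewrite mulrzBr mulrzA -pmulrn -xE mulr1z subrr.
  move=> /(torsion_free_mulrz tf x0) /eqP; rewrite subr_eq0 => /eqP /(congr1 absz).
  by rewrite abszM /= => /eqP; rewrite muln_eq1 => /andP[_ /eqP].
have hom M : (1 < M)%N -> exists d : nat, (0 < d)%N /\ forall m y, tree_group y ->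
    x = y *+ m -> exists k, (m %| M ^ k * d)%N.
  move=> M1; have [|rho [rhoH rhoK [j jE]]] := tree_group_hom zK KH Kx xind (M := M).
    exact: ltnW.
  have jE' : rho x = (1 + M%:Z * j)%:~R by rewrite intrD intrM jE -pmulrn.
  exists (absz (1 + M%:Z * j)); split.
    rewrite absz_gt0; apply/eqP => E.
    have /(congr1 absz) : M%:Z * j = -1 by lia.
    by rewrite abszM /= => /eqP; rewrite muln_eq1 => /andP[/eqP E' _]; rewrite E' in M1.
  move=> m y Hy xE; have [k /intrP[z zE]] := rhoH y Hy; exists k.
  have : (z * m%:Z = (M ^ k)%N%:Z * (1 + M%:Z * j)).
    apply/eqP; rewrite -(eqr_int rat) !intrM -zE -jE' xE raddfMn -!pmulrn natrX.
    by apply/eqP; rewrite -[rho y *+ m]mulr_natr; ring.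
  by move=> /(congr1 absz); rewrite !abszM /= => <-; exact: dvdn_mull.
have [d2 [d20 d2P]] := hom 2 isT; have [d3 [d30 d3P]] := hom 3 isT.
exists (d2 * d3)%N => m y Hy xE; apply: dvdn_leq; first by rewrite muln_gt0 d20.
have [k mk] := d2P _ _ Hy xE; have [l ml] := d3P _ _ Hy xE.
have : (m %| gcdn (2 ^ k * (d2 * d3)) (3 ^ l * (d2 * d3)))%N.
  by rewrite dvdn_gcd mulnA dvdn_mulr //= mulnCA dvdn_mull.
by rewrite -muln_gcdl (eqP (_ : coprime _ _)) ?mul1n // coprimeXl ?coprimeXr.
Qed.

(* If r x = d and s x = 1 + |d| k, a combination of r and s takes x to 1. *)
Lemma tree_group_unimodular (K : V -> Prop) (x : V) : zsub K ->
  (forall k, K k -> tree_group k) -> K x ->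
  (forall d k, K k -> x = k *+ d -> d = 1%N) ->
  exists rho : V -> rat, [/\ forall v w, rho (v - w) = rho v - rho w,
    forall k, K k -> is_int (rho k) & rho x = 1].
Proof.
move=> zK KH Kx xind.
(* M = 2 makes r x odd, hence nonzero, so that its absolute value can be the next modulus. *)
have [//|r [_ rK [j jE]]] := tree_group_hom zK KH Kx xind (M := 2).
have jE' : r x = (1 + 2 * j)%:~R by rewrite intrD intrM jE.
have d0 : (0 < absz (1 + 2 * j)%R)%N by rewrite absz_gt0; apply/eqP => E; lia.
have [s [_ sK [k kE]]] := tree_group_hom zK KH Kx xind d0.
have [e eE] : exists e : int, (absz (1 + 2 * j))%:Z * k = e * (1 + 2 * j).
  by exists (sgz (1 + 2 * j) * k); rewrite abszEsg; ring.
exists (fun v => s v - e%:~R * r v); split.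
- by move=> v w; rewrite (raddfB s) (raddfB r); ring.
- by move=> v Kv; apply: rpredB; [exact: sK|apply: rpredM; [exact: intr_int|exact: rK]].
by rewrite kE jE' pmulrn -intrM eE intrM addrK.
Qed.

End TreeGroup.

(** * Separability *)

Section Separable.
Variables (I : choiceType) (a : I -> nat -> bool) (p : nat -> nat).
Hypotheses (aQ : q_family a) (p_prime : forall n, prime (p n)) (p_inj : injective p).

Let V := qspace (seq bool + I)%type.
Let H := tree_group a p.

Variables (K : zmodType) (iota : {additive K -> V}).
Hypotheses (iota_inj : injective iota) (iotaH : forall k, H (iota k)).

Lemma tree_subgroup_torsion_free : torsion_free K.
Proof.
move=> k m m0 km; apply: iota_inj; rewrite raddf0.
by apply: (@qspace_torsion_free _ (iota k) m) => //; rewrite -raddfMn km raddf0.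
Qed.

(** Divisors of [g] are bounded, so [g] can be divided in [L] by a largest m. The quotient [y] is
    then no proper multiple in [L], as a functional with value 1 requires. *)
Lemma tree_subgroup_functional (L : K -> Prop) (g : K) : zsub L -> L g -> g <> 0 ->
  exists (y : K) (m : nat) (rho : K -> int), [/\ L y, g = y *+ m,
    forall k l, L k -> L l -> rho (k - l) = rho k - rho l & rho y = 1].
Proof.
move=> zL Lg g0.
have [|D DP] := tree_group_divisors aQ p_prime p_inj (iotaH g).
  by move=> E; apply: g0; apply: iota_inj; rewrite E raddf0.
pose P m := `[< exists2 k, L k & g = k *+ m >].
have exP : exists m, P m by exists 1%N; apply/asboolP; exists g.
have bP m : P m -> (m <= D)%N.
  by move=> /asboolP[k Lk gk]; apply: (DP m _ (iotaH k)); rewrite {1}gk raddfMn.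
case: (ex_maxnP exP bP) => m /asboolP[y Ly gy] mmax.
pose L' v := exists2 k, L k & v = iota k.
have zL' : zsub L'.
  split=> [|_ _ [k Lk ->] [l Ll ->]]; first by exists 0; [exact: zsub0|rewrite raddf0].
  by exists (k - l); [exact: zsubB|rewrite raddfB].
have [||d _ [k Lk ->] yk|rho [rhoB rhoL rhoy]] :=
    tree_group_unimodular aQ p_prime p_inj zL' (x := iota y).
- by move=> _ [k _ ->]; exact: iotaH.
- by exists y.
- have {}yk : y = k *+ d by apply: iota_inj; rewrite yk raddfMn.
  have m0 : (0 < m)%N by rewrite lt0n; apply/eqP => m0; apply: g0; rewrite gy m0 mulr0n.
  have d0 : (0 < d)%N.
    by rewrite lt0n; apply/eqP => d0; apply: g0; rewrite gy yk d0 mulr0n mul0rn.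
  have : P (d * m)%N by apply/asboolP; exists k => //; rewrite gy yk mulrnA.
  by move/mmax; rewrite -[X in (_ <= X)%N]mul1n leq_pmul2r // => d1; apply/eqP; rewrite eqn_leq d1.
have rhoz k : exists z : int, L k -> rho (iota k) = z%:~R.
  have [Lk|nLk] := pselect (L k); last by exists 0.
  by have /intrP[z zE] : is_int (rho (iota k)) by [apply: rhoL; exists k]; exists z.
have [f fE] := choice rhoz; exists y, m, f; split=> //.
- move=> k l Lk Ll; apply: (@intr_inj rat).
  by rewrite intrB -!fE // ?raddfB ?rhoB //; exact: zsubB.
by apply: (@intr_inj rat); rewrite -fE.
Qed.

(* A maximal system of elements x_i of S with dual functionals f_i on K is a
   basis of S, and the common kernel of the f_i is a complement. *)
Lemma tree_subgroup_separable : separable K.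
Proof.
have tfK := tree_subgroup_torsion_free.
move=> S pureS [r rP].
pose comb (x : nat -> subgrp S) n (h : nat -> int) : K := lincomb (val \o x) n h.
pose dual n := exists (x : nat -> subgrp S) (f : nat -> {additive K -> int}),
  forall i j, (i < n)%N -> (j < n)%N -> f i (val (x j)) = (i == j)%:R.
have combS x n h : comb x n h \in S.
  by apply: rpred_sum => i _; apply: rpredMz; exact: subgrp_valP.
have fcomb n (x : nat -> subgrp S) (f : nat -> {additive K -> int}) h i :
    (forall i j, (i < n)%N -> (j < n)%N -> f i (val (x j)) = (i == j)%:R) ->
    (i < n)%N -> f i (comb x n h) = h i.
  move=> fx ilt; rewrite additive_lincomb /lincomb (bigD1 (Ordinal ilt)) //=.
  rewrite fx // eqxx mulrzz mul1r big1 ?addr0 // => j.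
  by rewrite -val_eqE eq_sym /= => /negbTE ji; rewrite fx // ji mul0rz.
have indep n (x : nat -> subgrp S) (f : nat -> {additive K -> int}) :
    (forall i j, (i < n)%N -> (j < n)%N -> f i (val (x j)) = (i == j)%:R) ->
    independent [set y | exists2 i, (i < n)%N & y = x i].
  move=> fx s h us sX s0 y ys; have [j jn yj] := sX y ys.
  have [|phi phiE] := @additive_of _ _ (fun u : subgrp S => f j (val u)).
    by move=> u v; rewrite !raddfB.
  have := congr1 phi s0; rewrite raddf0 raddf_sum (bigD1_seq y) //=.
  rewrite raddfMz phiE yj fx // eqxx big1_seq ?addr0 => [|z /andP[zy zs]].
    by rewrite mulrzz mul1r.
  have [i ilt zi] := sX z zs; rewrite raddfMz phiE zi fx //.
  case: eqP => [ji|_]; last by rewrite mul0rz.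
  by case/negP: zy; rewrite zi ji.
have xinj n (x : nat -> subgrp S) (f : nat -> {additive K -> int}) :
    (forall i j, (i < n)%N -> (j < n)%N -> f i (val (x j)) = (i == j)%:R) ->
    uniq (mkseq x n).
  move=> fx; rewrite map_inj_in_uniq ?iota_uniq // => i j.
  rewrite !mem_iota /= !add0n => ilt jlt xij; apply/eqP.
  by have := fx i j ilt jlt; rewrite -xij fx // eqxx; case: (i == j).
have dual_le n : dual n -> (n <= r)%N.
  move=> [x [f fx]]; rewrite -[X in (X <= _)%N](size_mkseq x); apply: rP.
    exact: xinj fx.
  move=> s h us sX; apply: (indep n x f fx) => // y /sX /=.
  by move=> /mapP[i]; rewrite mem_iota /= add0n => ilt ->; exists i.
have ex0 : exists n, `[< dual n >].
  by exists 0%N; apply/asboolP; exists (fun=> 0), (fun=> \0 : {additive K -> int}).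
have bd n : `[< dual n >] -> (n <= r)%N by move/asboolP; exact: dual_le.
case: (ex_maxnP ex0 bd) => n /asboolP[x [f fx]] nmax.
pose proj k := k - comb x n (fun i => f i k).
have fproj i k : (i < n)%N -> f i (proj k) = 0.
  by move=> ilt; rewrite /proj raddfB /= (fcomb n x f) // subrr.
have projB k l : proj (k - l) = proj k - proj l.
  rewrite /proj; have -> : comb x n (fun i => f i (k - l)) =
    comb x n (fun i => f i k) - comb x n (fun i => f i l).
    by rewrite /comb lincombB; apply: eq_lincomb => i _; rewrite raddfB.
  by rewrite !opprD addrACA.
have comb0 k : (forall i, (i < n)%N -> f i k = 0) -> comb x n (fun i => f i k) = 0.
  by move=> fk; rewrite /comb -(lincomb0 (val \o x) n); apply: eq_lincomb => i /fk.
(* Otherwise [proj g], divided as far as possible in the common kernel [L], yields [y], which lies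
   in [S] by purity. Its functional on [L], composed with [proj], enlarges the dual system. *)
have span g : g \in S -> proj g = 0.
  move=> gS; apply: contrapT => pg0.
  pose L k := forall i, (i < n)%N -> f i k = 0.
  have zL : zsub L.
    split=> [i _|k l Lk Ll i ilt]; first by rewrite raddf0.
    by rewrite raddfB /= Lk // Ll // subrr.
  have Lproj k : L (proj k) by move=> i ilt; exact: fproj.
  have [y [m [rho [Ly gy rhoB rhoy]]]] := tree_subgroup_functional zL (Lproj g) pg0.
  have yS : y \in S.
    have m0 : (0 < m)%N by rewrite lt0n; apply/eqP => m0; apply: pg0; rewrite gy m0 mulr0n.
    have [|h hS yh] := pureS m y; first by rewrite -gy rpredB.
    by rewrite (torsion_free_inj tfK m0 yh).
  have [|fn fnE] := @additive_of _ _ (rho \o proj).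
    by move=> k l /=; rewrite projB rhoB.
  have projL k : L k -> proj k = k.
    by move=> Lk; rewrite /proj comb0 ?subr0.
  have projx j : (j < n)%N -> proj (val (x j)) = 0.
    move=> jn; apply/eqP; rewrite subr_eq0 -[X in X == _]/((val \o x) j).
    rewrite -(lincomb_proj (val \o x) jn); apply/eqP/eq_lincomb => i ilt.
    by rewrite fx.
  have rho0 : rho 0 = 0.
    by have := rhoB 0 0; rewrite !subrr; apply; exact: zsub0 zL.
  suff /asboolT/nmax : dual n.+1 by rewrite ltnn.
  exists (fun i => if (i == n)%N then Subgrp yS else x i), (fun i => if (i == n)%N then fn else f i).
  move=> i j; rewrite !ltnS (leq_eqVlt i) (leq_eqVlt j).
  case: eqP => [->|_] /= i_n; case: eqP => [->|_] /= j_n.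
  - by rewrite eqxx fnE /= projL.
  - by rewrite fnE /= projx // rho0 gtn_eqF.
  - by rewrite Ly // ltn_eqF.
  - exact: fx.
have combE g : g \in S -> g = comb x n (fun i => f i g).
  by move=> /span /eqP; rewrite subr_eq0 => /eqP.
split.
  exists [set y | exists2 i, (i < n)%N & y = x i]; split; first exact: indep fx.
  move=> g; exists (mkseq x n), (fun y => f (index y (mkseq x n)) (val g)); split.
    by move=> y /mapP[i]; rewrite mem_iota /= add0n => ilt ->; exists i.
  apply: val_inj; rewrite raddf_sum [LHS]combE; last exact: subgrp_valP.
  rewrite big_map /comb /lincomb -(big_mkord predT (fun i => val (x i) *~ f i (val g))).
  rewrite /index_iota subn0 !big_seq; apply: eq_bigr => i; rewrite mem_iota /= add0n => ilt.
  transitivity (val (x i *~ f i (val g))); first by rewrite raddfMz.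
  congr (val (_ *~ f _ _)).
  by rewrite -[in RHS](nth_mkseq 0 x ilt) index_uniq ?size_mkseq //; exact: xinj fx.
pose L k := forall i, (i < n)%N -> f i k = 0.
have zL : zsub L.
  split=> [i _|k l Lk Ll i ilt]; first by rewrite raddf0.
  by rewrite raddfB /= Lk // Ll // subrr.
exists (zsub_closed zL); split.
  move=> g gS /zsub_closedP Lg; by rewrite (combE g gS) comb0.
move=> g; exists (comb x n (fun i => f i g)), (proj g); split=> //.
  by apply/zsub_closedP => i ilt; exact: fproj.
by rewrite /proj addrC subrK.
Qed.

End Separable.

(** * Failure of the Whitehead property *)

Section NotWhitehead.
Variables (I : choiceType) (a : I -> nat -> bool) (p : nat -> nat).
Hypotheses (p_prime : forall n, prime (p n)) (p_inj : injective p).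

Let V := qspace (seq bool + I)%type.
Let H : zmodType := subgrp (zsub_closed (zsub_tree_group a p)).

Let P n := (\prod_(k < n) p k)%N.

(** The sequence is coherent: from stage n + 1 on its residue modulo [p n] is [b n]. It will give a
    homomorphism to Q / Z with value a_i(n) / p_n at (y_i + x_s) / p_n, where s = a_i|n. *)
Lemma chinese_sequence (b : nat -> bool) : exists A : nat -> int,
  (forall n, exists t : int, A n.+1 = A n + (P n)%:Z * t) /\
  forall n, exists t : int, A n.+1 = (b n)%:Z + (p n)%:Z * t.
Proof.
have step (x : nat * int) : exists t : int,
    exists s : int, x.2 + (P x.1)%:Z * t = (b x.1)%:Z + (p x.1)%:Z * s.
  case: x => n A /=; have [u [v uv]] := bezout_nat (coprime_prime_prod p_prime p_inj n).
  exists (((b n)%:Z - A) * v), (- ((b n)%:Z - A) * u).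
  have -> : (P n)%:Z * (((b n)%:Z - A) * v) = ((b n)%:Z - A) * (1 - u * (p n)%:Z).
    by rewrite -uv /P; ring.
  ring.
have [t tP] := choice step.
pose A := fix A n := if n is n'.+1 then A n' + (P n')%:Z * t (n', A n') else 0.
exists A; split=> n; first by exists (t (n, A n)).
by have [s sE] := tP (n, A n); exists s.
Qed.

(* A solution psi of the lifting problem would predict the bit a_i(n) from the
   node a_i|n and the integer psi(y_i). *)
Lemma tree_group_countable : whitehead H -> (forall i j, a i =1 a j -> i = j) ->
  countable [set: I].
Proof.
move=> wH ainj; have [A AP] := choice (fun i => chinese_sequence (a i)).
(* At stage N, x_s goes to 0 and y_i to [A i N]. On vectors with coordinates in (1 / P N) Z, later
   stages give the same value modulo Z. *)
pose c N (e : seq bool + I) : rat := if e is inr i then (A i N)%:~R else 0.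
have PS N : P N.+1 = (P N * p N)%N by rewrite /P big_ord_recr.
have cS N e : exists t : int, c N.+1 e = c N e + (P N)%:R * t%:~R.
  case: e => [s|i] /=; first by exists 0; rewrite mulr0 addr0.
  by have [t ->] := (AP i).1 N; exists t; rewrite intrD intrM -pmulrn.
pose lat N (v : V) := forall e, is_int ((P N)%:R * qcoord v e).
have latS N v : lat N v -> lat N.+1 v.
  move=> Lv e; rewrite PS natrM mulrAC; apply: rpredM; [exact: Lv|exact: is_int_nat].
have latle N N' v : (N <= N')%N -> lat N v ->
    lat N' v /\ is_int (eval (c N') v - eval (c N) v).
  move=> /subnK <-; elim: (N' - N)%N => [|d IH] Lv; first by rewrite subrr; split=> //; exact: is_int0.
  have [Lv' iv] := IH Lv; rewrite addSn; split; first exact: latS.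
  rewrite -(subrK (eval (c (d + N)%N) v) (eval (c (d + N).+1) v)) -addrA.
  apply: rpredD => //; rewrite !eval_sum -sumrB; apply: (zsub_sum zsub_int) => e _.
  have [t ->] := cS (d + N)%N e.
  rewrite [X in is_int X](_ : _ = ((P (d + N))%:R * qcoord v e) * t%:~R); last by ring.
  by apply: rpredM; [exact: Lv'|exact: intr_int].
pose E0 (u : H * rat) := exists2 N, lat N (val u.1) & is_int (u.2 - eval (c N) (val u.1)).
have pE0 : partial_hom is_int E0.
  split; first split.
  - exists 0%N; first by move=> e; rewrite raddf0 qcoord0 mulr0; exact: is_int0.
    by rewrite raddf0 raddf0 subr0; exact: is_int0.
  - move=> [u q] [v s] [N Nu qu] [N' Nv sv]; pose M := maxn N N'.
    have [Mu ucM] := latle N M _ (leq_maxl _ _) Nu.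
    have [Mv vcM] := latle N' M _ (leq_maxr _ _) Nv.
    exists M; first by move=> e; rewrite raddfB qcoordB mulrBr; apply: rpredB; [exact: Mu|exact: Mv].
    rewrite raddfB /= raddfB /=.
    rewrite [X in is_int X](_ : _ = (q - eval (c N) (val u) - (eval (c M) (val u) - eval (c N) (val u)))
      - (s - eval (c N') (val v) - (eval (c M) (val v) - eval (c N') (val v)))); last by ring.
    by apply: rpredB; apply: rpredB.
  - by move=> q [N _]; rewrite /= raddf0 raddf0 subr0.
have [psi psiE] := whitehead_extend wH pE0.
have HxP s : (node_gen I s : V) \in zsub_closed (zsub_tree_group a p).
  by apply/zsub_closedP => S zS Sx _ _.
have HyP i : (top_gen i : V) \in zsub_closed (zsub_tree_group a p).
  by apply/zsub_closedP => S zS _ Sy _.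
have HzP i n : (root_gen a p i n : V) \in zsub_closed (zsub_tree_group a p).
  by apply/zsub_closedP => S zS _ _ Sz.
pose X s : H := Subgrp (HxP s); pose Y i : H := Subgrp (HyP i).
pose Z i n : H := Subgrp (HzP i n).
have lat0 e : lat 0%N (basis e 1).
  move=> e'; rewrite /P big_ord0 mul1r qcoord_basis.
  by case: eqP => _; [exact: (is_int_nat 1)|exact: is_int0].
have psiX s : exists z : int, psi (X s) = z%:~R.
  apply/intrP; rewrite -[psi _]subr0; apply: psiE; exists 0%N; first exact: lat0.
  by rewrite /= eval_basis mulr0 subrr; exact: is_int0.
have psiY i : exists z : int, psi (Y i) = z%:~R.
  apply/intrP; rewrite -(subrK (A i 0%N)%:~R (psi (Y i))); apply: rpredD; last exact: intr_int.
  apply: psiE; exists 0%N; first exact: lat0.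
  by rewrite /= eval_basis mul1r subrr; exact: is_int0.
have [y yE] := choice psiY; have [x xE] := choice psiX.
have predict i n : exists t : int, y i + x (branch (a i) n) = (a i n)%:Z + (p n)%:Z * t.
  have pn0 : (p n)%:R != 0 :> rat by rewrite pnatr_eq0 -lt0n prime_gt0.
  have /intrP[s sE] : is_int (psi (Z i n) - (A i n.+1)%:~R / (p n)%:R).
    (* [P n.+1] is the first of the products that [p n] divides. *)
    apply: psiE; exists n.+1; last first.
      rewrite /= raddfD /= !eval_basis /= mulr0 addr0 [_ * (A i n.+1)%:~R]mulrC subrr.
      exact: is_int0.
    move=> e; rewrite PS natrM qcoordD !qcoord_basis /= -mulrA mulrDr.
    apply: rpredM; first exact: is_int_nat.
    apply: rpredD; case: eqP => _; rewrite ?mulr0 ?divff //; exact: rpred0 || exact: rpred1.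
  have [t tE] := (AP i).2 n; exists (t + s); apply: (@intr_inj rat).
  have bM (e : seq bool + I) : basis e (p n)%:R^-1 *+ p n = basis e 1.
    by rewrite -(raddfMn (basis e)); congr basis; rewrite -[LHS]mulr_natr mulVf.
  have ZE : Z i n *+ p n = Y i + X (branch (a i) n).
    apply: val_inj; rewrite raddfMn raddfD /= /root_gen /top_gen /node_gen mulrnDl.
    by rewrite !bM.
  rewrite intrD -yE -xE -raddfD -ZE raddfMn -mulr_natr.
  rewrite -(subrK ((A i n.+1)%:~R / (p n)%:R) (psi (Z i n))) sE mulrDl divfK // tE.
  rewrite !intrD !intrM -[(p n)%:Z%:~R]/((p n)%:R : rat) intrD; ring.
have code_inj : injective y.
  move=> i j yij; apply: ainj => n.
  (* Equal integers at the top and equal nodes make the next bits congruent modulo [p m] > 1, hence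
     equal. *)
  have br m : branch (a i) m = branch (a j) m.
    elim: m => //= m IH; congr (_ :: _) => //.
    have [s sE] := predict i m; have [t tE] := predict j m.
    have : (a i m)%:Z - (a j m)%:Z = (p m)%:Z * (t - s).
      by move: sE tE; rewrite yij IH => -> /eqP; lia.
    have := prime_gt1 (p_prime m); move: (t - s) (p m) => d q.
    case: (a i m) (a j m) => -[] //= q1 E; exfalso.
      have /(congr1 absz) : q%:Z * d = 1 by lia.
      by rewrite abszM /= => /eqP; rewrite muln_eq1 => /andP[/eqP E' _]; rewrite E' in q1.
    have /(congr1 absz) : q%:Z * d = -1 by lia.
    by rewrite abszM /= => /eqP; rewrite muln_eq1 => /andP[/eqP E' _]; rewrite E' in q1.
  by have [] := br n.+1.
apply/countable_injP; exists (pickle \o y) => i j _ _ /=.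
by move=> /(pcan_inj pickleK) /code_inj.
Qed.

End NotWhitehead.

Lemma prime_sequence : exists p : nat -> nat, (forall n, prime (p n)) /\ injective p.
Proof.
have [p [pP pS]] : exists p : nat -> nat,
    (forall n, prime (p n)) /\ forall n, (p n < p n.+1)%N.
  pose p := fix p n := sval (prime_above (if n is n'.+1 then p n' else 0%N)).
  by exists p; split=> [[|n]|n] /=; case: prime_above.
have mono : {homo p : m n / (m < n)%N} by apply: homo_ltn => //; exact: ltn_trans.
exists p; split=> // i j pij; apply/eqP; rewrite eqn_leq (leqNgt i) (leqNgt j).
by apply/andP; split; apply/negP => /mono; rewrite pij ltnn.
Qed.

Theorem theorem13 :
  (exists G : zmodType,
      whitehead G /\ cardinality_aleph1 G /\ ~ shelah_group G) ->
  exists H : zmodType, hereditarily_separable H /\ ~ whitehead H.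
Proof.
move=> [G [wG [cG nsh]]].
have [I [a [ncI aQ]]] := q_family_of_whitehead wG cG nsh.
have [p [p_prime p_inj]] := prime_sequence.
exists (subgrp (zsub_closed (zsub_tree_group a p))); split; last first.
  by move/(tree_group_countable p_prime p_inj) => H; apply/ncI/H/q_family_inj.
move=> S; pose iota (k : subgrp S) : qspace (seq bool + I)%type := val (val k).
have [|iota' iotaE] := @additive_of _ _ iota; first by move=> k l; rewrite /iota !raddfB.
apply: (@tree_subgroup_separable I a p aQ p_prime p_inj _ iota').
  by move=> k l; rewrite !iotaE => /val_inj /val_inj.
by move=> k; rewrite iotaE; have /zsub_closedP := subgrp_valP (val k).
Qed.
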